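(* Let $\mathbf{A}$ be a commutative $\mathrm{OI}$-algebra and consider a morphism of $\mathbf{A}$-modules $\varphi\colon\mathbf{F}\to\mathbf{A}$, where $\mathbf{F}$ is a finitely generated free $\mathbf{A}$-module. Then there is a complex of finitely generated free $\mathbf{A}$-modules $$\cdots\longrightarrow\bigwedge\nolimits^3\mathbf{F}\longrightarrow\bigwedge\nolimits^2\mathbf{F}\longrightarrow\bigwedge\nolimits^1\mathbf{F}\longrightarrow\bigwedge\nolimits^0\mathbf{F}=\mathbf{A}\longrightarrow0,$$ where each differential $\partial_i\colon\bigwedge^i\mathbf{F}\to\bigwedge^{i-1}\mathbf{F}$ is defined width-wise by letting $\partial_i(w)\colon\bigwedge^i(\mathbf{F}(w))\to\bigwedge^{i-1}(\mathbf{F}(w))$ be the degree $i$ map of the classical Koszul complex of the $\mathbf{A}(w)$-module homomorphism $\varphi(w)\colon\mathbf{F}(w)\to\mathbf{A}(w)$. This complex is generically acyclic (that is, there are choices of $\mathbf{A}$, $\mathbf{F}$ and $\varphi$ for which it is acyclic) and, if it is acyclic, it resolves $\operatorname{coker}\varphi$. Furthermore, if $\varphi$ is a morphism of graded $\mathbf{A}$-modules, then the complex with modules $\bigwedge^i\mathbf{F}$ ($i\ge0$) and differentials $\partial_i$ is a graded complex.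
   Context: Let $k$ be a commutative ring and $\mathbb{N}_0=\{0,1,2,\dots\}$. $\mathrm{OI}$ is the category of totally ordered finite sets with order-preserving injective maps; one works with its objects $[w]=\{1,\dots,w\}$, $w\in\mathbb{N}_0$, and denotes $[w]$ by $w$. An $\mathrm{OI}$-module is a functor from $\mathrm{OI}$ to $k$-modules. A commutative $\mathrm{OI}$-algebra $\mathbf{A}$ is a covariant functor from $\mathrm{OI}$ to commutative $k$-algebras. For an $\mathrm{OI}$-morphism $\varepsilon$, the induced map of any such functor is written $\varepsilon_*$. An $\mathbf{A}$-module $\mathbf{M}$ is an $\mathrm{OI}$-module such that each $\mathbf{M}(w)$ (the width $w$ component) is an $\mathbf{A}(w)$-module and $\varepsilon_*(am)=\varepsilon_*(a)\varepsilon_*(m)$ for all $\varepsilon\colon w\to w'$, $a\in\mathbf{A}(w)$, $m\in\mathbf{M}(w)$. A morphism of $\mathbf{A}$-modules is a natural transformation $\varphi\colon\mathbf{M}\to\mathbf{N}$ with every $\varphi(w)$ being $\mathbf{A}(w)$-linear. Kernels, images, cokernels and exactness are taken width-wise. For $n\in\mathbb{N}_0$, $\mathbf{F}^{\mathrm{OI},n}_{\mathbf{A}}$ is the $\mathbf{A}$-module whose width $w$ component is the free $\mathbf{A}(w)$-module with basis $\{e_\nu\mid\nu\in\operatorname{Hom}_{\mathrm{OI}}(n,w)\}$, and with $\varepsilon_*(\sum_\nu a_\nu e_\nu)=\sum_\nu\varepsilon_*(a_\nu)e_{\varepsilon\circ\nu}$ for $\varepsilon\colon w\to w'$. A finitely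 generated free $\mathbf{A}$-module (of rank $r$) is one isomorphic to $\mathbf{F}^{\mathrm{OI},n_1}_{\mathbf{A}}\oplus\cdots\oplus\mathbf{F}^{\mathrm{OI},n_r}_{\mathbf{A}}$. Tensor products of $\mathbf{A}$-modules are defined width-wise over $\mathbf{A}(w)$. The exterior algebra of $\mathbf{M}$ is the quotient of the tensor algebra $\mathbf{T}(\mathbf{M})=\mathbf{A}\oplus\mathbf{M}\oplus(\mathbf{M}\otimes_{\mathbf{A}}\mathbf{M})\oplus\cdots$ by the two-sided ideal generated by all $m\otimes m$ with $m$ in some $\mathbf{M}(w)$; its degree $i$ part is the $\mathbf{A}$-module $\bigwedge^i\mathbf{M}$, and $(\bigwedge^i\mathbf{M})(w)=\bigwedge^i(\mathbf{M}(w))$, the exterior power over $\mathbf{A}(w)$, with the induced maps. For a commutative ring $R$, a finitely generated free $R$-module $F$ and an $R$-linear map $\psi\colon F\to R$, the classical Koszul complex has the module $\bigwedge^dF$ in homological degree $d\ge0$ and, for $d\ge1$, degree $d$ map $e_1\wedge\cdots\wedge e_d\mapsto\sum_{j=1}^d(-1)^{j+1}\psi(e_j)\,e_1\wedge\cdots\wedge\widehat{e_j}\wedge\cdots\wedge e_d$ (for $e_1,\dots,e_d\in F$; the hat means omission). A complex concentrated in homological degrees $\ge0$ is acyclic if its homology vanishes in all positive degrees; it resolves $\mathbf{N}$ if moreover its degree $0$ homology is isomorphic to $\mathbf{N}$. Graded setting: a graded $\mathrm{OI}$-algebra is a functor to graded $k$-algebras; a graded $\mathbf{A}$-module has each $\mathbf{M}(w)$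 a graded $\mathbf{A}(w)$-module with all maps $\varepsilon_*$ of degree $0$; morphisms of graded modules have degree $0$ in every width (free modules have homogeneous bases, possibly with degree shifts). Exterior powers carry the induced gradings, and a graded complex is a complex of graded modules whose differentials are morphisms of graded modules. *)

(* Defs.v *)
From HB Require Import structures.
From mathcomp Require Import all_boot all_order all_algebra.
From mathcomp Require Import generic_quotient ring_quotient.
From mathcomp Require Import finmap.
From mathcomp Require Import boolp classical_sets functions cardinality fsbigop.

Set Implicit Arguments.
Unset Strict Implicit.
Unset Printing Implicit Defensive.

Import GRing.Theory.
Local Open Scope classical_set_scope.
Local Open Scope ring_scope.
Local Open Scope quotient_scope.

Section Span.
Variables (R : pzRingType) (V : lmodType R) (S : set V).

Definition lin_span : {pred V} := fun v =>
  `[< exists2 s : seq (R * V), (forall p, p \in s -> S p.2)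
        & v = \sum_(p <- s) p.1 *: p.2 >].

Lemma lin_spanP v : reflect (exists2 s : seq (R * V),
  (forall p, p \in s -> S p.2) & v = \sum_(p <- s) p.1 *: p.2) (v \in lin_span).
Proof. exact: asboolP. Qed.

Lemma sub_lin_span v : S v -> v \in lin_span.
Proof.
move=> Sv; apply/lin_spanP; exists [:: (1, v)]; first by move=> p; rewrite inE => /eqP->.
by rewrite big_seq1 scale1r.
Qed.

Lemma lin_span_scale a : {in lin_span, forall v, a *: v \in lin_span}.
Proof.
move=> _ /lin_spanP[s Ss ->]; apply/lin_spanP; exists [seq (a * p.1, p.2) | p <- s].
  by move=> _ /mapP[p ps ->] /=; apply: Ss.
by rewrite big_map scaler_sumr; apply: eq_bigr => p _; rewrite scalerA.
Qed.

Lemma lin_span_zmod : zmod_closed lin_span.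
Proof.
split=> [|u v us vs]; first by apply/lin_spanP; exists [::]; rewrite // big_nil.
have := lin_span_scale (- 1) vs; rewrite scaleN1r.
case/lin_spanP: us => s Ss ->; case/lin_spanP=> t St ->.
apply/lin_spanP; exists (s ++ t); last by rewrite big_cat.
by move=> p; rewrite mem_cat => /orP[/Ss|/St].
Qed.

HB.instance Definition _ := GRing.isZmodClosed.Build V lin_span lin_span_zmod.

End Span.

Section QuotientModule.
Variables (R : pzRingType) (V : lmodType R) (S : set V).

Definition quotmod : Type := @Quotient.quot V (lin_span S).
HB.instance Definition _ := GRing.Zmodule.on quotmod.

Definition quotmod_pi (v : V) : quotmod := \pi_(@Quotient.quot V (lin_span S)) v.
Definition quotmod_repr (u : quotmod) : V :=
  repr (u : @Quotient.quot V (lin_span S)).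

Lemma quotmod_reprK : cancel quotmod_repr quotmod_pi.
Proof. exact: reprK. Qed.

Lemma quotmod_piP u v : reflect (quotmod_pi u = quotmod_pi v) (u - v \in lin_span S).
Proof. by rewrite Quotient.idealrBE; apply: eqP. Qed.

Lemma quotmod_piB : zmod_morphism quotmod_pi.
Proof. by move=> u v; rewrite /quotmod_pi raddfB. Qed.
HB.instance Definition _ :=
  GRing.isZmodMorphism.Build V quotmod quotmod_pi quotmod_piB.

Definition quotmod_scale a (u : quotmod) := quotmod_pi (a *: quotmod_repr u).

Lemma quotmod_scaleE a v : quotmod_scale a (quotmod_pi v) = quotmod_pi (a *: v).
Proof.
apply/quotmod_piP; rewrite -scalerBr lin_span_scale //.
by apply/quotmod_piP; rewrite quotmod_reprK.
Qed.

Lemma quotmod_scaleA a b v :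
  quotmod_scale a (quotmod_scale b v) = quotmod_scale (a * b) v.
Proof. by rewrite -[v]quotmod_reprK !quotmod_scaleE scalerA. Qed.
Lemma quotmod_scale1 : left_id 1 quotmod_scale.
Proof. by move=> v; rewrite -[v]quotmod_reprK quotmod_scaleE scale1r. Qed.
Lemma quotmod_scaleDr : right_distributive quotmod_scale +%R.
Proof.
move=> a u v; rewrite -[u]quotmod_reprK -[v]quotmod_reprK -raddfD.
by rewrite !quotmod_scaleE -raddfD scalerDr.
Qed.
Lemma quotmod_scaleDl v : {morph quotmod_scale^~ v : a b / a + b}.
Proof.
by move=> a b; rewrite -[v]quotmod_reprK !quotmod_scaleE -raddfD scalerDl.
Qed.
HB.instance Definition _ := GRing.Zmodule_isLmodule.Build R quotmod
  quotmod_scaleA quotmod_scale1 quotmod_scaleDr quotmod_scaleDl.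

Lemma quotmod_piZ : scalable quotmod_pi.
Proof. by move=> a v; rewrite -quotmod_scaleE. Qed.
HB.instance Definition _ :=
  GRing.isScalable.Build R V quotmod _ quotmod_pi quotmod_piZ.

Lemma quotmod_pi0 v : S v -> quotmod_pi v = 0.
Proof.
by move=> Sv; rewrite -(raddf0 quotmod_pi); apply/quotmod_piP;
  rewrite subr0 sub_lin_span.
Qed.

End QuotientModule.

Section QuotientLift.
Variables (R R' : pzRingType) (nu : {rmorphism R -> R'}).
Variables (V : lmodType R) (S : set V) (W : lmodType R').
Variable g : {linear V -> W | nu \; *:%R}.

Definition quotmod_lift (g0 : forall v, S v -> g v = 0) (u : quotmod S) : W :=
  g (quotmod_repr u).

Variable g0 : forall v, S v -> g v = 0.

Lemma quotmod_liftE v : quotmod_lift g0 (quotmod_pi S v) = g v.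
Proof.
apply/eqP; rewrite -subr_eq0 -raddfB /=.
have /quotmod_piP/lin_spanP[s Ss ->] :
  quotmod_pi S (quotmod_repr (quotmod_pi S v)) = quotmod_pi S v.
  exact: quotmod_reprK.
rewrite linear_sum big_seq big1 // => p /Ss Sp.
by rewrite linearZ /= g0 ?scaler0.
Qed.

Lemma quotmod_lift_linear : linear_for (nu \; *:%R) (quotmod_lift g0).
Proof.
move=> a u v; rewrite -[u]quotmod_reprK -[v]quotmod_reprK -linearP.
by rewrite !quotmod_liftE linearP.
Qed.
HB.instance Definition _ := GRing.isLinear.Build R (quotmod S) W _
  (quotmod_lift g0) quotmod_lift_linear.

End QuotientLift.

Section FreeModule.
Variables (R : pzRingType) (X : choiceType).

Definition finite_supp : {pred X -> R^o} :=
  fun f => `[< finite_set [set x | f x != 0] >].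

Lemma finite_suppP f : reflect (finite_set [set x | f x != 0]) (f \in finite_supp).
Proof. exact: asboolP. Qed.

Lemma finite_supp_closed : submod_closed finite_supp.
Proof.
split=> [|a f g /finite_suppP fin_f /finite_suppP fin_g]; apply/finite_suppP.
  by apply: (sub_finite_set _ (finite_set0 X)) => x /=; rewrite eqxx.
apply: (@sub_finite_set _ _ ([set x | f x != 0] `|` [set x | g x != 0])).
  move=> x /= nz; have [gx0|/eqP ?] := pselect (g x = 0); last by right.
  left; apply: contra nz => /eqP fx0.
  by rewrite /GRing.add /= /GRing.scale /= gx0 fx0 scaler0 addr0.
by rewrite finite_setU.
Qed.

Record freemod := FreeMod {freemod_val :> X -> R^o; _ : freemod_val \in finite_supp}.
HB.instance Definition _ := [isSub for freemod_val].
HB.instance Definition _ := [Choice of freemod by <:].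
HB.instance Definition _ :=
  GRing.SubChoice_isSubLmodule.Build R (X -> R^o) finite_supp freemod
    (GRing.submod_closed_semi finite_supp_closed).

End FreeModule.

Section FreeModuleBasis.
Variables (R : pzRingType) (X : choiceType).
Implicit Types (f : freemod R X) (D : set X).

Lemma freemod_finite f : finite_set [set x | f x != 0].
Proof. by apply/finite_suppP; case: f. Qed.

Lemma freemodP f (g : freemod R X) : (forall x, f x = g x) -> f = g.
Proof. by move=> fg; apply: val_inj; apply: funext. Qed.

Definition freemod_delta_fun (y : X) : X -> R^o := fun x => (x == y)%:R.
Lemma freemod_delta_subproof y : freemod_delta_fun y \in @finite_supp R X.
Proof.
apply/finite_suppP/(@sub_finite_set _ _ [set y]) => // x /=.
by rewrite /freemod_delta_fun; have [//|_] := eqVneq x y; rewrite eqxx.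
Qed.
Definition freemod_delta y : freemod R X := FreeMod (freemod_delta_subproof y).

Lemma freemodZ a f x : (a *: f) x = a * f x.
Proof.
by have -> : freemod_val (a *: f) = a *: freemod_val f by exact: GRing.valZ.
Qed.

Lemma freemod_sum (s : seq X) (F : X -> freemod R X) y :
  (\sum_(x <- s) F x) y = \sum_(x <- s) F x y.
Proof.
elim: s => [|x s IHs]; first by rewrite !big_nil -[LHS]/(val _ y) raddf0.
by rewrite !big_cons -IHs -[LHS]/(val _ y) raddfD.
Qed.

Lemma freemod_sumE f :
  f = \sum_(x <- fset_set [set x | f x != 0]) (f x : R) *: freemod_delta x.
Proof.
apply: freemodP => y; rewrite freemod_sum.
under eq_bigr do rewrite freemodZ /= /freemod_delta_fun.
have [fy0|fy] := eqVneq (f y) 0.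
  rewrite fy0 big1 // => x _; case: eqP => [<-|_]; last by rewrite mulr0.
  by rewrite fy0 mul0r.
rewrite (bigD1_seq y) ?fset_uniq //=; last first.
  by rewrite in_fset_set ?inE //; apply: freemod_finite.
rewrite eqxx mulr1 big1 ?addr0 // => x /negPf; rewrite eq_sym => ->.
by rewrite mulr0.
Qed.

End FreeModuleBasis.

Section FreeModuleLift.
Variables (R R' : pzRingType) (nu : {rmorphism R -> R'}).
Variables (X : choiceType) (W : lmodType R') (h : X -> W).

Definition freemod_lift (f : freemod R X) : W :=
  \sum_(x \in [set x | f x != 0]) nu (f x) *: h x.

Lemma freemod_lift_widen (D : set X) (f : freemod R X) : finite_set D -> [set x | f x != 0] `<=` D ->
  freemod_lift f = \sum_(x <- fset_set D) nu (f x) *: h x.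
Proof.
move=> finD sfD; rewrite -fsbig_finite //; apply: fsbig_widen => // x [_ /=].
by move=> /negP; rewrite negbK => /eqP->; rewrite rmorph0 scale0r.
Qed.

Lemma freemod_lift_linear : linear_for (nu \; *:%R) freemod_lift.
Proof.
move=> a f g.
pose D := ([set x | f x != 0] `|` [set x | g x != 0]).
have finD : finite_set D by rewrite finite_setU; split; apply: freemod_finite.
rewrite !(@freemod_lift_widen D) //; last 3 first.
- by move=> x; right.
- by move=> x; left.
- move=> x /= nz; have [gx0|/eqP ?] := pselect (g x = 0); last by right.
  left; apply: contra nz => /eqP fx0; rewrite /= /GRing.add /= /GRing.scale /=.
  by rewrite gx0 fx0 scaler0 addr0.
rewrite /= scaler_sumr -big_split; apply: eq_bigr => x _ /=.
by rewrite scalerA -scalerDl -rmorphM -rmorphD.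
Qed.
HB.instance Definition _ := GRing.isLinear.Build R (freemod R X) W _
  freemod_lift freemod_lift_linear.

Lemma freemod_lift_delta x : freemod_lift (freemod_delta R x) = h x.
Proof.
rewrite (@freemod_lift_widen [set x]) ?fset_set1 //=; last first.
  by move=> y /=; rewrite /freemod_delta_fun; have [//|_] := eqVneq y x; rewrite eqxx.
by rewrite big_seq_fset1 /freemod_delta_fun eqxx rmorph1 scale1r.
Qed.

Lemma freemod_ext (f g : {linear freemod R X -> W | nu \; *:%R}) :
  (forall x, f (freemod_delta R x) = g (freemod_delta R x)) -> f =1 g.
Proof.
move=> fg u; rewrite (freemod_sumE u) !linear_sum; apply: eq_bigr => x _.
by rewrite !linearZ /= fg.
Qed.

End FreeModuleLift.

Section ExteriorPower.
Variables (R : comPzRingType) (V : lmodType R) (i : nat).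
Implicit Types (x : {ffun 'I_i -> V}) (j : 'I_i).

Definition set_entry x j (y : V) : {ffun 'I_i -> V} :=
  [ffun l => if l == j then y else x l].

Inductive multilinear_rel : set (freemod R {ffun 'I_i -> V}) :=
| MultilinearD x j y z : multilinear_rel
    (freemod_delta R (set_entry x j (y + z))
       - (freemod_delta R (set_entry x j y) + freemod_delta R (set_entry x j z)))
| MultilinearZ x j a y : multilinear_rel
    (freemod_delta R (set_entry x j (a *: y))
       - a *: freemod_delta R (set_entry x j y)).

(* The i-fold tensor power V (x)_R ... (x)_R V, i.e. the degree i part of the
   tensor algebra of V. *)
Definition tpower : lmodType R := quotmod multilinear_rel.
Definition tensor x : tpower := quotmod_pi multilinear_rel (freemod_delta R x).

Lemma tensorD x j y z :
  tensor (set_entry x j (y + z)) =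
  tensor (set_entry x j y) + tensor (set_entry x j z).
Proof.
apply/eqP; rewrite -subr_eq0 /tensor -!linearD -linearB.
by apply/eqP/quotmod_pi0/MultilinearD.
Qed.

Lemma tensorZ x j a y :
  tensor (set_entry x j (a *: y)) = a *: tensor (set_entry x j y).
Proof.
apply/eqP; rewrite -subr_eq0 /tensor -linearZ -linearB.
by apply/eqP/quotmod_pi0/MultilinearZ.
Qed.

(* The pure tensors a (x) m (x) m (x) b, which span the degree i part of the
   two-sided ideal of the tensor algebra generated by all m (x) m. *)
Inductive alternating_rel : set tpower :=
| Alternating x (j l : 'I_i) :
    l = j.+1 :> nat -> x j = x l -> alternating_rel (tensor x).

Definition extpower : lmodType R := quotmod alternating_rel.
Definition wedge x : extpower := quotmod_pi alternating_rel (tensor x).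

End ExteriorPower.

Section ExteriorPowerMap.
Variables (R R' : comPzRingType) (nu : {rmorphism R -> R'}) (i : nat).
Variables (V : lmodType R) (W : lmodType R').

Lemma extpower_ext (U : lmodType R')
    (f g : {linear extpower V i -> U | nu \; *:%R}) :
  (forall x, f (wedge x) = g (wedge x)) -> f =1 g.
Proof.
move=> fg u; rewrite -[u]quotmod_reprK -[quotmod_repr u]quotmod_reprK.
move: (quotmod_repr _) => w; rewrite (freemod_sumE w) !linear_sum.
by apply: eq_bigr => x _; rewrite !linearZ /= fg.
Qed.

Variable f : {linear V -> W | nu \; *:%R}.

Definition map_entries (x : {ffun 'I_i -> V}) : {ffun 'I_i -> W} :=
  [ffun j => f (x j)].

Lemma map_set_entry x j y :
  map_entries (set_entry x j y) = set_entry (map_entries x) j (f y).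
Proof. by apply/ffunP => l; rewrite !ffunE; case: eqP. Qed.

Let free_map : {linear freemod R {ffun 'I_i -> V} -> tpower W i | nu \; *:%R} :=
  freemod_lift nu (fun x => tensor (map_entries x)).

Lemma free_map_rel u : multilinear_rel u -> free_map u = 0.
Proof.
case=> [x j y z|x j a y]; apply/eqP.
  rewrite linearB linearD /= !freemod_lift_delta !map_set_entry linearD.
  by rewrite tensorD subrr.
rewrite linearB linearZ /= !freemod_lift_delta !map_set_entry linearZ.
by rewrite /= tensorZ subrr.
Qed.

Let tpower_map : {linear tpower V i -> tpower W i | nu \; *:%R} :=
  quotmod_lift free_map_rel.

Lemma tpower_mapE x : tpower_map (tensor x) = tensor (map_entries x).
Proof. exact: etrans (quotmod_liftE _ _) (freemod_lift_delta _ _ _). Qed.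

Lemma wedge_map_linear :
  linear_for (nu \; *:%R) (fun u => quotmod_pi (@alternating_rel R' W i) (tpower_map u)).
Proof. by move=> a u v; rewrite linearP /= linearP. Qed.
Let wedge_map : {linear tpower V i -> extpower W i | nu \; *:%R} :=
  HB.pack (fun u => quotmod_pi (@alternating_rel R' W i) (tpower_map u))
    (GRing.isLinear.Build _ _ _ _ _ wedge_map_linear).

Lemma wedge_map_rel u : alternating_rel u -> wedge_map u = 0.
Proof.
case=> x j l jl xjl; apply: etrans (congr1 _ (tpower_mapE x)) _.
by apply/quotmod_pi0/Alternating; [apply: jl|rewrite !ffunE xjl].
Qed.

Definition extpower_map : {linear extpower V i -> extpower W i | nu \; *:%R} :=
  quotmod_lift wedge_map_rel.

Lemma extpower_map_wedge x : extpower_map (wedge x) = wedge (map_entries x).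
Proof.
rewrite /wedge -tpower_mapE /extpower_map; exact: (quotmod_liftE wedge_map_rel).
Qed.

End ExteriorPowerMap.

Definition oi_pred m n (f : {ffun 'I_m -> 'I_n}) : bool :=
  injectiveb f
  && [forall a : 'I_m, forall b : 'I_m, (a <= b)%N ==> (f a <= f b)%N].

(* The object [w] is 'I_w = {0, ..., w - 1}. *)
Record oihom m n :=
  OIHom {oihom_val :> {ffun 'I_m -> 'I_n}; oihomP : oi_pred oihom_val}.
HB.instance Definition _ m n := [isSub for @oihom_val m n].
HB.instance Definition _ m n := [Finite of oihom m n by <:].

Lemma oi_id_subproof n : oi_pred [ffun a : 'I_n => a].
Proof.
apply/andP; split; first by apply/injectiveP => a b; rewrite !ffunE.
by apply/'forall_forallP => a b; rewrite !ffunE; apply/implyP.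
Qed.
Definition oi_id n : oihom n n := OIHom (oi_id_subproof n).

Lemma oi_comp_subproof l m n (g : oihom m n) (f : oihom l m) :
  oi_pred [ffun a => g (f a)].
Proof.
case/andP: (oihomP g) => /injectiveP g_inj /'forall_forallP g_mono.
case/andP: (oihomP f) => /injectiveP f_inj /'forall_forallP f_mono.
apply/andP; split; first by apply/injectiveP => a b; rewrite !ffunE => /g_inj/f_inj.
apply/'forall_forallP => a b; apply/implyP => ab; rewrite !ffunE.
by apply: (implyP (g_mono _ _)); apply: (implyP (f_mono _ _)).
Qed.
Definition oi_comp l m n (g : oihom m n) (f : oihom l m) : oihom l n :=
  OIHom (oi_comp_subproof g f).

Lemma oihom_eqP m n (f g : oihom m n) : (forall a, f a = g a) -> f = g.
Proof. by move=> fg; apply/val_inj/ffunP. Qed.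

Lemma oi_comp_id m n (f : oihom m n) : oi_comp f (oi_id m) = f.
Proof. by apply: oihom_eqP => a; rewrite !ffunE. Qed.
Lemma oi_id_comp m n (f : oihom m n) : oi_comp (oi_id n) f = f.
Proof. by apply: oihom_eqP => a; rewrite !ffunE. Qed.
Lemma oi_compA l m n p (h : oihom n p) (g : oihom m n) (f : oihom l m) :
  oi_comp h (oi_comp g f) = oi_comp (oi_comp h g) f.
Proof. by apply: oihom_eqP => a; rewrite !ffunE. Qed.

(* Commutative k-algebras are commutative rings with a structure morphism from
   k: unlike comAlgType, this includes the zero algebra. *)
Record oialg (k : comPzRingType) := OIAlg {
  alg_at :> nat -> comPzRingType;
  alg_scal : forall w, {rmorphism k -> alg_at w};
  alg_map : forall m n, oihom m n -> {rmorphism alg_at m -> alg_at n};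
  alg_map_scal : forall m n (e : oihom m n) c,
    alg_map e (alg_scal m c) = alg_scal n c;
  alg_map_id : forall n a, alg_map (oi_id n) a = a;
  alg_map_comp : forall l m n (g : oihom m n) (f : oihom l m) a,
    alg_map (oi_comp g f) a = alg_map g (alg_map f a)
}.

(* The k-module structure of mod_at w is the one restricted along alg_scal w;
   the k-linearity of mod_map e follows from its semilinearity. *)
Record oimod (k : comPzRingType) (A : oialg k) := OIMod {
  mod_at :> forall w, lmodType (A w);
  mod_map : forall m n (e : oihom m n),
    {linear mod_at m -> mod_at n | alg_map A e \; *:%R};
  mod_map_id : forall n x, mod_map (oi_id n) x = x;
  mod_map_comp : forall l m n (g : oihom m n) (f : oihom l m) x,
    mod_map (oi_comp g f) x = mod_map g (mod_map f x)
}.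
Arguments mod_map {k A} o [m n] e.

Record oimod_hom (k : comPzRingType) (A : oialg k) (M N : oimod A) := OIModHom {
  hom_at :> forall w, {linear M w -> N w};
  hom_natural : forall m n (e : oihom m n) x,
    hom_at n (mod_map M e x) = mod_map N e (hom_at m x)
}.

Section Modules.
Variables (k : comPzRingType) (A : oialg k).
Implicit Types M N : oimod A.

Definition mutually_inverse M N (f : oimod_hom M N) (g : oimod_hom N M) :=
  forall w, cancel (f w) (g w) /\ cancel (g w) (f w).

Definition is_isomorphism M N (f : oimod_hom M N) :=
  exists g : oimod_hom N M, mutually_inverse f g.

Definition isomorphic M N := exists f : oimod_hom M N, is_isomorphism f.

Section Regular.

Definition reg_map m n (e : oihom m n) : (A m)^o -> (A n)^o := alg_map A e.
Lemma reg_map_linear m n (e : oihom m n) :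
  linear_for (alg_map A e \; *:%R) (reg_map e).
Proof. by move=> a x y; rewrite /reg_map rmorphD rmorphM. Qed.
HB.instance Definition _ m n (e : oihom m n) :=
  GRing.isLinear.Build _ _ _ _ (reg_map e) (reg_map_linear e).

Definition oireg : oimod A :=
  @OIMod k A (fun w => (A w)^o) reg_map (@alg_map_id k A) (@alg_map_comp k A).

End Regular.

Section Zero.

Definition zero_map m n (e : oihom m n) : 'rV[A m]_0 -> 'rV[A n]_0 := fun=> 0.
Lemma zero_map_linear m n (e : oihom m n) :
  linear_for (alg_map A e \; *:%R) (zero_map e).
Proof. by move=> a x y; rewrite /zero_map /= scaler0 addr0. Qed.
HB.instance Definition _ m n (e : oihom m n) :=
  GRing.isLinear.Build _ _ _ _ (zero_map e) (zero_map_linear e).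

Lemma zero_map_id n x : zero_map (oi_id n) x = x.
Proof. by rewrite [x]thinmx0. Qed.
Lemma zero_map_comp l m n (g : oihom m n) (f : oihom l m) x :
  zero_map (oi_comp g f) x = zero_map g (zero_map f x).
Proof. by []. Qed.

Definition oizero : oimod A :=
  @OIMod k A (fun w => 'rV[A w]_0) zero_map zero_map_id zero_map_comp.

End Zero.

Section DirectSum.
Variables M N : oimod A.

Definition dsum_map m n (e : oihom m n) (x : (M m * N m)%type) : (M n * N n)%type :=
  (mod_map M e x.1, mod_map N e x.2).
Lemma dsum_map_linear m n (e : oihom m n) :
  linear_for (alg_map A e \; *:%R) (dsum_map e).
Proof. by move=> a x y; rewrite /dsum_map !linearP. Qed.
HB.instance Definition _ m n (e : oihom m n) :=
  GRing.isLinear.Build _ _ _ _ (dsum_map e) (dsum_map_linear e).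

Lemma dsum_map_id n x : dsum_map (oi_id n) x = x.
Proof. by case: x => x y; rewrite /dsum_map !mod_map_id. Qed.
Lemma dsum_map_comp l m n (g : oihom m n) (f : oihom l m) x :
  dsum_map (oi_comp g f) x = dsum_map g (dsum_map f x).
Proof. by rewrite /dsum_map !mod_map_comp. Qed.

Definition oidsum : oimod A :=
  @OIMod k A (fun w => (M w * N w)%type) dsum_map dsum_map_id dsum_map_comp.

End DirectSum.

Section Free.
Variable n : nat.

Definition free_at w := {ffun oihom n w -> (A w)^o}.
Definition free_basis w (nu : oihom n w) : free_at w :=
  [ffun mu => (mu == nu)%:R].

Definition free_map w w' (e : oihom w w') (x : free_at w) : free_at w' :=
  \sum_nu alg_map A e (x nu) *: free_basis (oi_comp e nu).
Lemma free_map_linear w w' (e : oihom w w') :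
  linear_for (alg_map A e \; *:%R) (free_map e).
Proof.
move=> a x y; rewrite /= scaler_sumr -big_split; apply: eq_bigr => nu _ /=.
by rewrite !ffunE rmorphD rmorphM scalerDl scalerA.
Qed.
HB.instance Definition _ w w' (e : oihom w w') :=
  GRing.isLinear.Build _ _ _ _ (free_map e) (free_map_linear e).

Lemma free_sum_basis w (x : free_at w) : \sum_nu (x nu : A w) *: free_basis nu = x.
Proof.
apply/ffunP => mu; rewrite sum_ffunE (bigD1 mu) //= !ffunE eqxx.
rewrite big1 ?addr0; first exact: mulr1.
by move=> nu /negPf nu_mu; rewrite !ffunE eq_sym nu_mu; apply: mulr0.
Qed.

Lemma free_map_basis w w' (e : oihom w w') nu :
  free_map e (free_basis nu) = free_basis (oi_comp e nu).
Proof.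
rewrite /free_map (bigD1 nu) //= ffunE eqxx rmorph1 scale1r big1 ?addr0 //.
by move=> mu /negPf mu_nu; rewrite ffunE mu_nu rmorph0 scale0r.
Qed.

Lemma free_map_id w x : free_map (oi_id w) x = x.
Proof.
rewrite -[RHS]free_sum_basis; apply: eq_bigr => nu _.
by rewrite alg_map_id oi_id_comp.
Qed.
Lemma free_map_comp w w' w'' (g : oihom w' w'') (f : oihom w w') x :
  free_map (oi_comp g f) x = free_map g (free_map f x).
Proof.
rewrite [free_map f x]/free_map linear_sum; apply: eq_bigr => nu _.
by rewrite linearZ /= free_map_basis alg_map_comp oi_compA.
Qed.

Definition oifree : oimod A :=
  @OIMod k A (fun w => free_at w) free_map free_map_id free_map_comp.

End Free.

Fixpoint free_dsum (ns : seq nat) : oimod A :=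
  if ns is n :: ns' then oidsum (oifree n) (free_dsum ns') else oizero.

Definition fg_free M := exists ns, isomorphic M (free_dsum ns).

Section Ext.
Variables (M : oimod A) (i : nat).

Definition ext_map m n (e : oihom m n) :
    {linear extpower (M m) i -> extpower (M n) i | alg_map A e \; *:%R} :=
  extpower_map i (mod_map M e).

Lemma ext_map_id n x : ext_map (oi_id n) x = x.
Proof.
have id_linear : linear_for (alg_map A (oi_id n) \; *:%R)
    (@id (extpower (M n) i)).
  by move=> a u v; rewrite /= alg_map_id.
pose idl : {linear extpower (M n) i -> extpower (M n) i
                 | alg_map A (oi_id n) \; *:%R} :=
  HB.pack (@id (extpower (M n) i)) (GRing.isLinear.Build _ _ _ _ _ id_linear).
apply: (@extpower_ext _ _ _ _ _ _ (ext_map (oi_id n)) idl) => y.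
rewrite extpower_map_wedge; congr wedge.
by apply/ffunP => j; rewrite ffunE mod_map_id.
Qed.

Lemma ext_map_comp l m n (g : oihom m n) (f : oihom l m) x :
  ext_map (oi_comp g f) x = ext_map g (ext_map f x).
Proof.
have gf_linear : linear_for (alg_map A (oi_comp g f) \; *:%R)
    (ext_map g \o ext_map f).
  move=> a u v; apply: etrans (congr1 (ext_map g) (linearP (ext_map f) a u v)) _.
  by apply: etrans (linearP (ext_map g) _ _ _) _; rewrite /= alg_map_comp.
pose gf : {linear extpower (M l) i -> extpower (M n) i
                 | alg_map A (oi_comp g f) \; *:%R} :=
  HB.pack (ext_map g \o ext_map f) (GRing.isLinear.Build _ _ _ _ _ gf_linear).
apply: (@extpower_ext _ _ _ _ _ _ (ext_map (oi_comp g f)) gf) => y.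
rewrite extpower_map_wedge.
apply: esym; apply: etrans (congr1 (ext_map g) (extpower_map_wedge _ y)) _.
apply: etrans (extpower_map_wedge _ _) _; congr wedge.
by apply/ffunP => j; rewrite !ffunE mod_map_comp.
Qed.

Definition oiext : oimod A :=
  @OIMod k A (fun w => extpower (M w) i) ext_map ext_map_id ext_map_comp.

End Ext.

Section Cokernel.
Variables (M N : oimod A) (f : oimod_hom M N).

Definition coker_at w : lmodType (A w) := quotmod (range (f w)).

Definition coker_proj m n (e : oihom m n) (x : N m) : coker_at n :=
  quotmod_pi (range (f n)) (mod_map N e x).
Lemma coker_proj_linear m n (e : oihom m n) :
  linear_for (alg_map A e \; *:%R) (coker_proj e).
Proof. by move=> a x y; rewrite /coker_proj linearP linearP. Qed.
HB.instance Definition _ m n (e : oihom m n) :=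
  GRing.isLinear.Build _ _ _ _ (coker_proj e) (coker_proj_linear e).

Lemma coker_proj0 m n (e : oihom m n) x : range (f m) x -> coker_proj e x = 0.
Proof.
case=> y _ <-; rewrite /coker_proj -hom_natural.
by apply/quotmod_pi0; exists (mod_map M e y).
Qed.

Definition coker_map m n (e : oihom m n) :
    {linear coker_at m -> coker_at n | alg_map A e \; *:%R} :=
  quotmod_lift (@coker_proj0 m n e).

Lemma coker_map_pi m n (e : oihom m n) x :
  coker_map e (quotmod_pi _ x) = quotmod_pi _ (mod_map N e x).
Proof. exact: (quotmod_liftE (@coker_proj0 m n e)). Qed.

Lemma coker_map_id n x : coker_map (oi_id n) x = x.
Proof. by rewrite -[x]quotmod_reprK coker_map_pi mod_map_id. Qed.
Lemma coker_map_comp l m n (g : oihom m n) (h : oihom l m) x :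
  coker_map (oi_comp g h) x = coker_map g (coker_map h x).
Proof. by rewrite -[x]quotmod_reprK !coker_map_pi mod_map_comp. Qed.

Definition oicoker : oimod A :=
  @OIMod k A coker_at coker_map coker_map_id coker_map_comp.

End Cokernel.

End Modules.

Section Koszul.
Variables (R : comPzRingType) (V : lmodType R).

Definition omit d (x : {ffun 'I_d.+1 -> V}) (j : 'I_d.+1) : {ffun 'I_d -> V} :=
  [ffun l => x (lift j l)].

(* D is the degree d + 1 map of the Koszul complex of psi. Entries are numbered
   from 0, so the sign of the j-th term is (-1)^j; the wedges span the source,
   so D is determined by psi. *)
Definition is_koszul_map (psi : {linear V -> R^o}) d
    (D : {linear extpower V d.+1 -> extpower V d}) :=
  forall x, D (wedge x) =
    \sum_(j < d.+1) ((-1) ^+ j * (psi (x j) : R)) *: wedge (omit x j).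

Definition extunit : extpower V 0 := wedge [ffun=> 0].

End Koszul.

Section Complexes.
Variables (k : comPzRingType) (A : oialg k).

(* A complex  ... -> C 2 -> C 1 -> C 0 -> 0  with prescribed modules;
   differential i is the differential of homological degree i + 1. *)
Record oicomplex (C : nat -> oimod A) := OIComplex {
  differential : forall i, oimod_hom (C i.+1) (C i);
  differential2_eq0 : forall i w (x : C i.+2 w),
    differential i w (differential i.+1 w x) = 0
}.

Variables (C : nat -> oimod A) (K : oicomplex C).

Definition acyclic :=
  forall i w (x : C i.+1 w), differential K i w x = 0 ->
  exists y : C i.+2 w, differential K i.+1 w y = x.

(* Everything in degree 0 is a cycle. *)
Definition homology0 : oimod A := oicoker (differential K 0).

Definition resolves (N : oimod A) := acyclic /\ isomorphic homology0 N.

End Complexes.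

Section KoszulComplex.
Variables (k : comPzRingType) (A : oialg k) (F : oimod A).

Definition ext0_map w (a : (A w)^o) : oiext F 0 w := (a : A w) *: extunit (F w).
Lemma ext0_map_linear w : linear (@ext0_map w).
Proof. by move=> a x y; rewrite /ext0_map scalerDl -scalerA. Qed.
HB.instance Definition _ w :=
  GRing.isLinear.Build _ _ _ _ (@ext0_map w) (@ext0_map_linear w).

Lemma ext0_natural m n (e : oihom m n) (a : oireg A m) :
  ext0_map (mod_map (oireg A) e a) = mod_map (oiext F 0) e (ext0_map a).
Proof.
rewrite [in RHS]/ext0_map linearZ /ext0_map; congr (_ *: _).
rewrite /extunit; apply: esym; apply: etrans (extpower_map_wedge _ _) _.
by congr wedge; apply/ffunP => -[].
Qed.

Definition ext0 : oimod_hom (oireg A) (oiext F 0) :=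
  @OIModHom k A (oireg A) (oiext F 0) (fun w => @ext0_map w) ext0_natural.

Definition is_koszul_complex (phi : oimod_hom F (oireg A))
    (K : oicomplex (oiext F)) :=
  forall i w, is_koszul_map (phi w) (differential K i w).

End KoszulComplex.

(* V is the direct sum of the subgroups g d. *)
Record is_grading (V : zmodType) (g : int -> set V) : Prop := IsGrading {
  grading0 : forall d, g d 0;
  gradingB : forall d x y, g d x -> g d y -> g d (x - y);
  grading_sum : forall x, exists (s : seq int) (c : int -> V),
    [/\ uniq s, forall d, g d (c d) & x = \sum_(d <- s) c d];
  grading_direct : forall (s : seq int) (c : int -> V),
    uniq s -> (forall d, g d (c d)) -> \sum_(d <- s) c d = 0 ->
    forall d, d \in s -> c d = 0
}.

Section Graded.
Variables (k : comPzRingType) (A : oialg k).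
Implicit Types (gA : forall w, int -> set (A w)) (M N : oimod A).

Record graded_oialg gA : Prop := GradedOIAlg {
  oialg_grading : forall w, is_grading (gA w);
  oialg_graded_scal : forall w c, gA w 0 (alg_scal A w c);
  oialg_gradedM : forall w d e a b,
    gA w d a -> gA w e b -> gA w (d + e) (a * b);
  oialg_graded_map : forall m n (f : oihom m n) d a,
    gA m d a -> gA n d (alg_map A f a)
}.

Record graded_oimod gA M (gM : forall w, int -> set (M w)) : Prop :=
  GradedOIMod {
  oimod_grading : forall w, is_grading (gM w);
  oimod_gradedZ : forall w d e a x,
    gA w d a -> gM w e x -> gM w (d + e) (a *: x);
  oimod_graded_map : forall m n (f : oihom m n) d x,
    gM m d x -> gM n d (mod_map M f x)
}.

Definition graded_hom M N (gM : forall w, int -> set (M w))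
    (gN : forall w, int -> set (N w)) (f : oimod_hom M N) :=
  forall w d x, gM w d x -> gN w d (f w x).

(* The free module on n with its basis placed in degree c. *)
Definition free_gr gA n (c : int) w (d : int) : set (oifree A n w) :=
  [set x | forall nu, gA w (d - c) (x nu)].

Fixpoint free_dsum_gr gA (ncs : seq (nat * int)) w (d : int) :
    set (free_dsum A (map fst ncs) w) :=
  match ncs with
  | [::] => setT
  | nc :: ncs' =>
      [set x : (oifree A nc.1 w * free_dsum A (map fst ncs') w)%type |
        free_gr gA nc.2 d x.1 /\ @free_dsum_gr gA ncs' w d x.2]
  end.

Arguments free_dsum_gr : clear implicits.

Definition graded_fg_free gA M (gM : forall w, int -> set (M w)) :=
  exists ncs : seq (nat * int),
  exists (f : oimod_hom M (free_dsum A (map fst ncs)))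
         (g : oimod_hom (free_dsum A (map fst ncs)) M),
  [/\ mutually_inverse f g, graded_hom gM (free_dsum_gr gA ncs) f
    & graded_hom (free_dsum_gr gA ncs) gM g].

(* Spanned by the a *: (x_1 ^ ... ^ x_i) with a and all x_j homogeneous of
   total degree d. The coefficient a matters when i = 0. *)
Definition ext_gr gA M (gM : forall w, int -> set (M w)) i w (d : int) :
    set (oiext M i w) :=
  [set u | exists2 s : seq (A w * {ffun 'I_i -> M w}),
    forall p, p \in s -> exists (d0 : int) (c : 'I_i -> int),
      [/\ gA w d0 p.1, forall j, gM w (c j) (p.2 j) & d = d0 + \sum_j c j]
  & u = \sum_(p <- s) p.1 *: wedge p.2].

Definition graded_complex gA (C : nat -> oimod A)
    (gC : forall i w, int -> set (C i w)) (K : oicomplex C) :=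
  (forall i, graded_oimod gA (gC i))
  /\ (forall i, graded_hom (gC i.+1) (gC i) (differential K i)).

End Graded.

(* Main.v *)
(* The Koszul formula is multilinear and alternating in the entries of a wedge,
   so it descends to exterior powers; it is natural in semilinear maps, hence
   gives maps of A-modules.

   If F is free with generators j in J of width n j, then F w has a basis indexed
   by the pairs (j, nu) with nu : n j -> w, on which OI acts. An i-element set of
   such pairs has a support in [w], the union of the images of its maps nu, and
   is the image of a unique set of full support under the unique OI-morphism with
   that image. Hence the i-th exterior power of F is free on the wedges of the
   i-element sets of full support, one ordering being chosen for each of them;
   full support bounds the width by i * max_j n j, so there are finitely many.
   Independence is tested by determinants of coordinates. For a homogeneous basis
   these determinants are homogeneous, which makes the sum of the homogeneous
   parts of the exterior power direct.

   An acyclic instance is F = 0. *)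

Require Import Defs.
From HB Require Import structures.
From mathcomp Require Import boolp classical_sets.
From mathcomp Require Import all_boot all_order all_algebra all_fingroup.

Set Implicit Arguments.
Unset Strict Implicit.
Unset Printing Implicit Defensive.

(** * Alternating maps *)

Section Alternating.
Import GRing.Theory.
Local Open Scope ring_scope.

Section AlternatingMaps.
Variables (R : comPzRingType) (V W : lmodType R) (i : nat).
Implicit Types (x : {ffun 'I_i -> V}) (j l : 'I_i).

(** Only adjacent equal entries are required to give zero, matching [alternating_rel];
    [alternating_eq0] extends this to arbitrary positions. *)
Record alternating (f : {ffun 'I_i -> V} -> W) : Prop := {
  alternatingD : forall x j y z, f (set_entry x j (y + z)) =
    f (set_entry x j y) + f (set_entry x j z);
  alternatingZ : forall x j a y, f (set_entry x j (a *: y)) =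
    a *: f (set_entry x j y);
  alternating_adjacent : forall x j l, l = j.+1 :> nat -> x j = x l -> f x = 0
}.

Lemma set_entry_id x j : set_entry x j (x j) = x.
Proof. by apply/ffunP => l; rewrite ffunE; case: eqP => [->|]. Qed.

Lemma set_entryC x j l y z : j != l ->
  set_entry (set_entry x j y) l z = set_entry (set_entry x l z) j y.
Proof.
move=> /negPf jl; apply/ffunP => m; rewrite !ffunE.
by have [->|] := eqVneq m l; rewrite // eq_sym jl.
Qed.

Definition permute (T : Type) (s : 'S_i) (x : {ffun 'I_i -> T}) :
  {ffun 'I_i -> T} := [ffun j => x (s j)].

Variable f : {ffun 'I_i -> V} -> W.
Hypothesis f_alt : alternating f.

(** Polarization: expand [f] at the family with [x j + x l] in both positions. The pair [j], [l] is
    fixed, so the fact is available for adjacent pairs before it is known for all pairs. *)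
Let swap_of_eq0 j l : j != l -> (forall x, x j = x l -> f x = 0) ->
  forall x, f (permute (tperm j l) x) = - f x.
Proof.
move=> jl f0 x; pose X y z := set_entry (set_entry x j y) l z.
have X0 y : f (X y y) = 0 by apply: f0; rewrite !ffunE (negPf jl) !eqxx.
have XDl y y' z : f (X (y + y') z) = f (X y z) + f (X y' z).
  by rewrite /X !(set_entryC _ _ _ jl) (alternatingD f_alt).
have XDr y z z' : f (X y (z + z')) = f (X y z) + f (X y z').
  exact: (alternatingD f_alt).
have -> : permute (tperm j l) x = X (x l) (x j).
  apply/ffunP => m; rewrite !ffunE.
  have [->|ml] := eqVneq m l; first by rewrite tpermR.
  by have [->|mj] := eqVneq m j; rewrite ?tpermL // tpermD 1?eq_sym.
have -> : f x = f (X (x j) (x l)) by rewrite /X set_entry_id set_entry_id.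
have := X0 (x j + x l); rewrite XDl !XDr !X0 add0r addr0 addrC => /eqP.
by rewrite addr_eq0 => /eqP.
Qed.

Lemma alternating_eq0 x j l : j != l -> x j = x l -> f x = 0.
Proof.
wlog jl : j l / (j < l)%N.
  move=> IH; rewrite neq_ltn => /orP[jl|lj] xjl.
    by apply: (IH j l); rewrite // neq_ltn jl.
  by apply: (IH l j); rewrite // neq_ltn lj.
(* Adjacent swaps only change the sign and bring the equal entries together. *)
move=> _; have [n] := ubnP (l - j)%N.
elim: n l jl x => // n IHn l jl x le_ln xjl.
have [lj|lj] := eqVneq (l : nat) j.+1.
  exact: (alternating_adjacent f_alt lj).
have l_gt0 : (0 < l)%N by apply: leq_trans jl.
have ltj : (j < l.-1)%N.
  by rewrite -ltnS prednK // ltn_neqAle jl andbT; apply: contraNneq lj => ->.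
have lt_l : (l.-1 < i)%N by apply: leq_ltn_trans (leq_pred _) (ltn_ord l).
pose l' := Ordinal lt_l.
have l'l : l = l'.+1 :> nat by rewrite /= prednK.
have l'Nl : l' != l by rewrite -val_eqE /= neq_ltn [l in (_ < l)%N]l'l ltnSn.
apply: oppr_inj; rewrite oppr0 -(swap_of_eq0 l'Nl); last first.
  by move=> y; apply: alternating_adjacent.
apply: (IHn l') => //.
  by rewrite -ltnS; apply: leq_trans le_ln; rewrite ltnS /= ltn_sub2r // l'l.
rewrite !ffunE tpermL tpermD // -val_eqE /= neq_ltn ?ltj ?orbT //.
by rewrite jl orbT.
Qed.

Lemma alternating_permute (s : 'S_i) x : f (permute s x) = (-1) ^+ s *: f x.
Proof.
have [ts -> ts_neq] := prod_tpermP s.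
elim: ts x ts_neq => [|[j l] ts IHts] x /= => [_|/andP[jl ts_neq]].
  rewrite big_nil odd_perm1 scale1r; congr f.
  by apply/ffunP => m; rewrite ffunE perm1.
rewrite big_cons odd_mul_tperm jl /=.
have -> : permute (tperm j l * \prod_(t <- ts) tperm t.1 t.2)%g x =
          permute (tperm j l) (permute (\prod_(t <- ts) tperm t.1 t.2)%g x).
  by apply/ffunP => m; rewrite !ffunE permM.
rewrite (swap_of_eq0 jl); last by move=> y; apply: alternating_eq0.
by rewrite IHts // signrN scaleNr.
Qed.

Lemma alternating0 x j : x j = 0 -> f x = 0.
Proof.
by rewrite -{2}(set_entry_id x j) => ->; rewrite -(scale0r 0) alternatingZ // scale0r.
Qed.

Lemma alternating_sum I (r : seq I) (F : I -> V) x j :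
  f (set_entry x j (\sum_(t <- r) F t)) = \sum_(t <- r) f (set_entry x j (F t)).
Proof.
elim: r => [|t r IHr]; last by rewrite !big_cons alternatingD // IHr.
by rewrite !big_nil (@alternating0 _ j) // ffunE eqxx.
Qed.

(* P plays the role of a submodule: expanding one entry after the other, the values
   of f lie in the submodule spanned by its values on families with entries in S. *)
Lemma alternating_ind (S : 'I_i -> V -> Prop) (P : W -> Prop) :
    P 0 -> (forall u v, P u -> P v -> P (u + v)) ->
    (forall a u, P u -> P (a *: u)) ->
    (forall x, (forall j, S j (x j)) -> P (f x)) ->
  forall x, (forall j, exists2 s : seq (R * V), (forall p, p \in s -> S j p.2) &
    x j = \sum_(p <- s) p.1 *: p.2) -> P (f x).
Proof.
move=> P0 PD PZ PS.
(* Induction on the number [n] of leading entries that are still combinations; the entries from [n]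
   on already lie in [S]. *)
suff H n x : (forall j, (j < n)%N -> exists2 s : seq (R * V),
    (forall p, p \in s -> S j p.2) & x j = \sum_(p <- s) p.1 *: p.2) ->
    (forall j, (n <= j)%N -> S j (x j)) -> P (f x).
  by move=> x xS; apply: (H i) => // j; rewrite leqNgt ltn_ord.
elim: n x => [|n IHn] x xlt xge; first by apply: PS => j; apply: xge.
have [le_in|lt_ni] := leqP i n.
  apply: IHn => j; first by move=> /leqW; apply: xlt.
  by rewrite leqNgt (leq_trans (ltn_ord j)).
pose j := Ordinal lt_ni; have [s sS xj] := xlt j (ltnSn n).
rewrite -(set_entry_id x j) xj alternating_sum big_seq.
apply: (big_ind P) => // p ps; rewrite (alternatingZ f_alt).
apply/PZ/IHn => l; rewrite ffunE.
  move=> ln; have /negPf-> : l != j by rewrite -val_eqE neq_ltn ln.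
  exact/xlt/leqW.
have [->|lj] := eqVneq l j; first by move=> _; apply: sS.
move=> nl; apply: xge; rewrite ltn_neqAle nl andbT.
by apply: contraNneq lj => nl'; apply/eqP/val_inj.
Qed.

End AlternatingMaps.

Section Exterior.
Variables (R : comPzRingType) (V W : lmodType R) (i : nat).

Lemma wedge_alternating : alternating (@wedge R V i).
Proof.
split=> [x j y z|x j a y|x j l lj xjl].
- by rewrite /wedge tensorD linearD.
- by rewrite /wedge tensorZ linearZ.
- by apply: quotmod_pi0; apply: Alternating lj xjl.
Qed.

Lemma wedge_span (u : extpower V i) : exists s : seq (R * {ffun 'I_i -> V}),
  u = \sum_(p <- s) p.1 *: wedge p.2.
Proof.
rewrite -[u]quotmod_reprK -[quotmod_repr u]quotmod_reprK.
move: (quotmod_repr _) => w; rewrite (freemod_sumE w) !linear_sum.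
eexists [seq (w x : R, x) | x <- _]; rewrite big_map; apply: eq_bigr => x _.
by rewrite !linearZ.
Qed.

(** Universal property of the exterior power: the map descends from the free module on families to
    the tensor power by multilinearity, and then to the exterior power by vanishing on adjacent
    equal entries. *)
Lemma alternating_lift (f : {ffun 'I_i -> V} -> W) : alternating f ->
  exists F : {linear extpower V i -> W}, forall x, F (wedge x) = f x.
Proof.
move=> f_alt.
(* Linear maps are treated as semilinear along [idfun], the form that the lifts produce; [f3_linear]
   turns the result back into a plain linear map. *)
pose f1 : {linear freemod R {ffun 'I_i -> V} -> W | idfun \; *:%R} :=
  freemod_lift idfun f.
have f1_0 u : multilinear_rel u -> f1 u = 0.
  case=> [x j y z|x j a y]; apply/eqP.
    by rewrite linearB linearD /= !freemod_lift_delta alternatingD // subrr.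
  by rewrite linearB linearZ /= !freemod_lift_delta alternatingZ // subrr.
pose f2 : {linear tpower V i -> W | idfun \; *:%R} := quotmod_lift f1_0.
have f2E x : f2 (tensor x) = f x.
  exact: etrans (quotmod_liftE _ _) (freemod_lift_delta _ _ _).
have f2_0 u : alternating_rel u -> f2 u = 0.
  by case=> x j l lj xjl; rewrite f2E; apply: alternating_adjacent lj xjl.
pose f3 : {linear extpower V i -> W | idfun \; *:%R} := quotmod_lift f2_0.
have f3_linear : linear f3 by move=> a u v; rewrite linearP.
pose F : {linear extpower V i -> W} :=
  HB.pack (f3 : extpower V i -> W) (GRing.isLinear.Build _ _ _ _ _ f3_linear).
by exists F => x; rewrite -f2E; apply: (quotmod_liftE f2_0).
Qed.

End Exterior.
End Alternating.

(** * The Koszul complex *)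

Section KoszulMap.
Import GRing.Theory.
Local Open Scope ring_scope.

Section KoszulSum.
Variables (R : comPzRingType) (V : lmodType R).

Lemma omit_set_entry d (x : {ffun 'I_d.+1 -> V}) j y :
  omit (set_entry x j y) j = omit x j.
Proof. by apply/ffunP => l; rewrite !ffunE eq_sym (negPf (neq_lift j l)). Qed.

Lemma omit_set_entry_lift d (x : {ffun 'I_d.+1 -> V}) j l y :
  omit (set_entry x (lift j l) y) j = set_entry (omit x j) l y.
Proof. by apply/ffunP => m; rewrite !ffunE (inj_eq lift_inj). Qed.

Lemma omit_adjacent d (x : {ffun 'I_d.+1 -> V}) (j l : 'I_d.+1) :
  l = j.+1 :> nat -> x j = x l -> omit x l = omit x j.
Proof.
move=> lj xjl; apply/ffunP => m; rewrite !ffunE.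
have [mj|mj] := eqVneq (m : nat) j.
  have -> : lift j m = l by apply: val_inj; rewrite /= /bump mj leqnn lj.
  have -> // : lift l m = j.
  by apply: val_inj; rewrite /= /bump mj lj ltnn.
by congr (x _); apply: val_inj; rewrite /= /bump lj ltn_neqAle eq_sym mj.
Qed.

Variable psi : {linear V -> R^o}.

Definition koszul_sum d (x : {ffun 'I_d.+1 -> V}) : extpower V d :=
  \sum_(j < d.+1) ((-1) ^+ j * (psi (x j) : R)) *: wedge (omit x j).

(** Expanding entry [l]: the term omitting it depends on it through [psi], the other terms through
    the wedge. If adjacent entries agree, the two terms omitting one of them have opposite signs and
    equal wedges; all other terms keep both entries and vanish. *)
Lemma koszul_sum_alternating d : alternating (@koszul_sum d).
Proof.
have wedge_alt := @wedge_alternating R V d.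
split=> [x l y z|x l a y|x j l lj xjl].
- rewrite -big_split; apply: eq_bigr => j _ /=.
  case: (unliftP j l) => [m ->|->]; last first.
    by rewrite !omit_set_entry !ffunE !eqxx linearD mulrDr scalerDl.
  rewrite !omit_set_entry_lift (alternatingD wedge_alt) scalerDr.
  by rewrite !ffunE (negPf (neq_lift j m)).
- rewrite scaler_sumr; apply: eq_bigr => j _ /=.
  case: (unliftP j l) => [m ->|->]; last first.
    by rewrite !omit_set_entry !ffunE !eqxx linearZ /= mulrCA scalerA.
  rewrite !omit_set_entry_lift (alternatingZ wedge_alt).
  by rewrite !ffunE (negPf (neq_lift j m)) !scalerA mulrC.
- have Nlj : l != j by rewrite -val_eqE /= lj neq_ltn ltnSn orbT.
  rewrite /koszul_sum (bigD1 j) // (bigD1 l) //= big1 ?addr0 => [|p]; last first.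
    case/andP => pj pl.
    case: (unliftP p j) => [j' jj'|/eqP]; last by rewrite eq_sym (negPf pj).
    case: (unliftP p l) => [l' ll'|/eqP]; last by rewrite eq_sym (negPf pl).
    rewrite (@alternating_eq0 _ _ _ _ _ wedge_alt _ j' l') ?scaler0 //.
      by apply: contraNneq Nlj => jl; rewrite jj' ll' jl.
    by rewrite !ffunE -jj' -ll'.
  by rewrite (omit_adjacent lj xjl) xjl -scalerDl lj exprS mulN1r mulNr addrN scale0r.
Qed.

Definition koszul_map d : {linear extpower V d.+1 -> extpower V d} :=
  sval (cid (alternating_lift (@koszul_sum_alternating d))).

Lemma koszul_mapP d : is_koszul_map psi (koszul_map d).
Proof. exact: (svalP (cid (alternating_lift (@koszul_sum_alternating d)))). Qed.

Lemma is_koszul_map2 d (D : {linear extpower V d.+1 -> extpower V d})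
    (D' : {linear extpower V d.+2 -> extpower V d.+1}) :
  is_koszul_map psi D -> is_koszul_map psi D' -> forall u, D (D' u) = 0.
Proof.
move=> DE D'E u; have [s ->] := wedge_span u; rewrite !linear_sum big1 // => p _.
rewrite !linearZ /= D'E; move: p.2 => x.
suff -> : D (\sum_(j < d.+2) ((-1) ^+ j * (psi (x j) : R)) *: wedge (omit x j)) = 0.
  by rewrite scaler0.
pose F (q : 'I_d.+2 * 'I_d.+1) : extpower V d :=
  ((-1) ^+ (q.1 + q.2) * ((psi (x q.1) : R) * psi (x (lift q.1 q.2))))
    *: wedge (omit (omit x q.1) q.2).
transitivity (\sum_q F q).
  rewrite linear_sum -(pair_bigA _ (fun j l => F (j, l))); apply: eq_bigr => j _ /=.
  rewrite linearZ /= DE scaler_sumr; apply: eq_bigr => l _.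
  by rewrite scalerA /F ffunE /= exprD mulrACA.
(* The entries q.1 and lift q.1 q.2 can be omitted in two orders; h passes from one
   order to the other, which changes the sign of the term. *)
pose h (q : 'I_d.+2 * 'I_d.+1) : 'I_d.+2 * 'I_d.+1 := (lift q.1 q.2, inord q.1).
pose h' (q : 'I_d.+2 * 'I_d.+1) : 'I_d.+2 * 'I_d.+1 := (inord q.2, inord q.1.-1).
have Fh (q : 'I_d.+2 * 'I_d.+1) : (q.1 <= q.2)%N -> F (h q) = - F q.
  case: q => j l /= jl; rewrite /F /=.
  have jd : (j < d.+1)%N by apply: leq_ltn_trans jl _.
  have -> : lift (lift j l) (inord j) = j.
    apply: val_inj; rewrite /= /bump inordK // jl.
    by rewrite leqNgt ltnS jl.
  have -> : omit (omit x (lift j l)) (inord j) = omit (omit x j) l.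
    apply/ffunP => m; rewrite !ffunE; congr (x _); apply: val_inj.
    by rewrite /= inordK // [RHS]bumpC /unbump ltnNge jl subn0.
  rewrite /bump jl inordK // add1n addSn exprS mulN1r mulNr scaleNr addnC.
  by rewrite [(psi _ : R) * _]mulrC.
rewrite (bigID (fun q : 'I_d.+2 * 'I_d.+1 => (q.1 <= q.2)%N)) /=.
(* [h] carries the pairs with [q.1 <= q.2] bijectively onto the remaining pairs, with inverse [h'],
   so the two halves of the sum cancel term by term. *)
rewrite [X in _ + X](reindex_onto h h') /=; last first.
  case=> j l /=; rewrite -ltnNge => lj; rewrite /h /h' /=; congr (_, _).
    have j_gt0 : (0 < j)%N by apply: leq_trans lj.
    have j1 : (j.-1 < d.+1)%N by rewrite prednK // -ltnS.
    apply: val_inj; rewrite /= /bump !inordK //; last by rewrite (ltn_trans (ltn_ord l)).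
    by rewrite -ltnS prednK // lj add1n prednK.
  by apply: val_inj; rewrite /= !inordK // (ltn_trans (ltn_ord l)).
have Ph (q : 'I_d.+2 * 'I_d.+1) :
    ~~ (bump q.1 q.2 <= (inord q.1 : 'I_d.+1))%N && (h' (h q) == q) = (q.1 <= q.2)%N.
  case: q => j l; rewrite /h /h' /= /bump xpair_eqE -!val_eqE /=.
  have [jl|lj] := leqP j l.
    have jd : (j < d.+1)%N by apply: leq_ltn_trans jl _.
    by rewrite add1n !inordK //= ?inordK // ?eqxx -?ltnNge ?ltnS ?jl // ltnW.
  apply/negbTE; rewrite negb_and add0n negbK; have [jd|jd] := ltnP j d.+1.
    by rewrite [(inord j : 'I_d.+1) : nat]inordK // ltnW.
  (* Here [j] is the last index [d.+1], outside the range of [inord]. Whatever value [inord j] takes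
     lies below [d.+1], so [h'] cannot recover [j]. *)
  apply/orP; right; rewrite negb_and; apply/orP; left.
  rewrite inordK; last exact: leq_trans (ltn_ord _) _.
  by rewrite neq_ltn (leq_trans (ltn_ord (inord j : 'I_d.+1))).
rewrite [X in _ + X](eq_big _ _ Ph (fun q Pq => Fh q (etrans (esym (Ph q)) Pq))).
by rewrite -big_split big1 // => q _; rewrite /= addrN.
Qed.

End KoszulSum.

Section Naturality.
Variables (R R' : comPzRingType) (nu : {rmorphism R -> R'}).
Variables (V : lmodType R) (V' : lmodType R') (g : {linear V -> V' | nu \; *:%R}).
Variables (psi : {linear V -> R^o}) (psi' : {linear V' -> R'^o}).

Lemma extpower_mapZ_wedge d a (x : {ffun 'I_d -> V}) :
  extpower_map d g (a *: wedge x) = nu a *: wedge (map_entries g x).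
Proof. by rewrite linearZ; congr (_ *: _); exact: extpower_map_wedge. Qed.

(** With [g] induced by an OI-morphism, this is the naturality of the differentials. Wedges span,
    and on a wedge both sides are the same signed sum because [g] intertwines [psi] and [psi']. *)
Lemma is_koszul_map_natural d (D : {linear extpower V d.+1 -> extpower V d})
    (D' : {linear extpower V' d.+1 -> extpower V' d}) :
  (forall v, psi' (g v) = nu (psi v)) ->
  is_koszul_map psi D -> is_koszul_map psi' D' ->
  forall u, D' (extpower_map d.+1 g u) = extpower_map d g (D u).
Proof.
move=> psig DE D'E u; have [s ->] := wedge_span u; rewrite !linear_sum.
apply: eq_bigr => p _; rewrite extpower_mapZ_wedge [D _]linearZ [D' _]linearZ.
transitivity (nu p.1 *: extpower_map d g (D (wedge p.2))); last first.
  by apply/esym; rewrite linearZ.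
rewrite [D' _]D'E [D _]DE linear_sum; congr (_ *: _); apply: eq_bigr => j _.
rewrite extpower_mapZ_wedge ffunE psig rmorphM rmorphXn rmorphN1.
by congr (_ *: wedge _); apply/ffunP => l; rewrite !ffunE.
Qed.
End Naturality.
End KoszulMap.

(** * Isomorphisms and cokernels of OI-modules, and the Koszul complex over OI *)

Section OIModules.
Import GRing.Theory.
Local Open Scope ring_scope.

Lemma quotmod_descend (R : pzRingType) (V W : lmodType R) (S : set V)
    (g : {linear V -> W}) : (forall v, S v -> g v = 0) ->
  exists h : {linear quotmod S -> W}, forall v, h (quotmod_pi S v) = g v.
Proof.
move=> g0; exists (@quotmod_lift R R idfun V S W g g0 : {linear _ -> _ | idfun \; *:%R}).
exact: (@quotmod_liftE R R idfun V S W g g0).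
Qed.

Variables (k : comPzRingType) (A : oialg k).
Implicit Types M N : oimod A.

(** Injectivity of [f] transfers linearity and naturality to the width-wise inverses. *)
Lemma bijective_isomorphism M N (f : oimod_hom M N) :
  (forall w, bijective (f w)) -> is_isomorphism f.
Proof.
move=> f_bij.
have inv w : {g : N w -> M w | cancel (f w) g /\ cancel g (f w)}.
  by apply: cid; case: (f_bij w) => g; exists g.
pose g w := sval (inv w).
have fK w : cancel (f w) (g w) by case: (svalP (inv w)).
have gK w : cancel (g w) (f w) by case: (svalP (inv w)).
have g_linear w : linear (g w).
  by move=> a x y; apply: (can_inj (fK w)); rewrite linearP !gK.
pose G w : {linear N w -> M w} :=
  HB.pack (g w) (GRing.isLinear.Build _ _ _ _ _ (g_linear w)).
have G_natural m n (e : oihom m n) x : G n (mod_map N e x) = mod_map M e (G m x).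
  by apply: (can_inj (fK n)); rewrite hom_natural !gK.
by exists (OIModHom G_natural) => w; split => x; [apply: fK | apply: gK].
Qed.

Lemma ext0_isomorphism (F : oimod A) : is_isomorphism (ext0 F).
Proof.
apply: bijective_isomorphism => w.
(* A family indexed by ['I_0] has no entries, so the constant 1 is vacuously alternating; its lift
   is the inverse of [ext0]. *)
have one_alt : alternating (fun _ : {ffun 'I_0 -> F w} => 1 : (A w)^o).
  by split=> ? [].
have [h hE] := alternating_lift one_alt; exists h => [a|u].
  by rewrite linearZ /= hE; apply: mulr1.
have [s ->] := wedge_span u; rewrite !linear_sum; apply: eq_bigr => p _.
have -> : wedge p.2 = extunit (F w) by congr wedge; apply/ffunP => -[].
by rewrite linearZ /= hE /ext0_map; congr (_ *: _); apply: mulr1.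
Qed.

(** The sources [M] and [M'] need not be related: [b] and its inverse descend to the quotients as
    soon as the images correspond. *)
Lemma coker_isomorphic M N M' N' (f : oimod_hom M N) (f' : oimod_hom M' N')
    (b : oimod_hom N N') : is_isomorphism b ->
  (forall w y, range (f w) y <-> range (f' w) (b w y)) ->
  isomorphic (oicoker f) (oicoker f').
Proof.
case=> b' bb' ff'.
have bK w : cancel (b w) (b' w) by case: (bb' w).
have b'K w : cancel (b' w) (b w) by case: (bb' w).
have pb0 w v : range (f w) v -> (quotmod_pi (range (f' w)) \o b w) v = 0.
  by move=> /ff'; apply: quotmod_pi0.
have pb'0 w v : range (f' w) v -> (quotmod_pi (range (f w)) \o b' w) v = 0.
  by move=> f'v; apply/quotmod_pi0/ff'; rewrite b'K.
pose h w := sval (cid (quotmod_descend (@pb0 w))).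
have hE w v : h w (quotmod_pi _ v) = quotmod_pi _ (b w v).
  exact: (svalP (cid (quotmod_descend (@pb0 w)))).
pose h' w := sval (cid (quotmod_descend (@pb'0 w))).
have h'E w v : h' w (quotmod_pi _ v) = quotmod_pi _ (b' w v).
  exact: (svalP (cid (quotmod_descend (@pb'0 w)))).
have h_natural m n (e : oihom m n) x :
    h n (mod_map (oicoker f) e x) = mod_map (oicoker f') e (h m x).
  rewrite -[x]quotmod_reprK hE.
  apply: etrans (congr1 (h n) (coker_map_pi _ _ _)) _.
  by apply: etrans _ (esym (coker_map_pi _ _ _)); rewrite hE hom_natural.
exists (@OIModHom k A (oicoker f) (oicoker f') h h_natural).
apply: bijective_isomorphism => w; exists (h' w) => u /=.
  by rewrite -[u]quotmod_reprK hE h'E bK.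
by rewrite -[u]quotmod_reprK h'E hE b'K.
Qed.

Lemma isomorphic_sym M N : isomorphic M N -> isomorphic N M.
Proof. by case=> f [g fg]; exists g; exists f => w; case: (fg w). Qed.

Section KoszulComplex.
Variables (F : oimod A) (phi : oimod_hom F (oireg A)).

Lemma koszul_natural i m n (e : oihom m n) (u : oiext F i.+1 m) :
  koszul_map (phi n) i (mod_map (oiext F i.+1) e u) =
  mod_map (oiext F i) e (koszul_map (phi m) i u).
Proof.
have phi_e v : phi n (mod_map F e v) = alg_map A e (phi m v).
  exact: hom_natural.
exact (is_koszul_map_natural phi_e (@koszul_mapP _ _ (phi m) i)
  (@koszul_mapP _ _ (phi n) i) u).
Qed.

Definition koszul_hom i : oimod_hom (oiext F i.+1) (oiext F i) :=
  @OIModHom k A (oiext F i.+1) (oiext F i)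
    (fun w => koszul_map (phi w) i) (@koszul_natural i).

Definition koszul_complex : oicomplex (oiext F) :=
  @OIComplex k A (oiext F) koszul_hom
    (fun i w => is_koszul_map2 (@koszul_mapP _ _ (phi w) i) (@koszul_mapP _ _ (phi w) i.+1)).

Lemma koszul_complexP : is_koszul_complex phi koszul_complex.
Proof. by move=> i w; apply: koszul_mapP. Qed.

(** Under the identification [ext0] of the degree 0 term with the algebra, the first differential is
    [phi] itself, so both maps have the same image. *)
Lemma koszul_homology0 K : is_koszul_complex phi K ->
  isomorphic (homology0 K) (oicoker phi).
Proof.
move=> phiK; apply/isomorphic_sym/(coker_isomorphic (ext0_isomorphism F)) => w a.
have d0 v : differential K 0 w (wedge [ffun=> v]) = ext0 F w (phi w v).
  rewrite phiK big_ord1 expr0 mul1r ffunE; congr (_ *: wedge _).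
  by apply/ffunP => -[].
split=> [[v _ <-]|[u _ /esym ua]]; first by exists (wedge [ffun=> v]).
(* A combination of wedges of length one corresponds to the same combination of their single
   entries; this is the preimage under [phi]. *)
have [s su] := wedge_span u; exists (\sum_(p <- s) p.1 *: p.2 ord0) => //.
have [h /(_ w)[/can_inj ext0_inj _]] := ext0_isomorphism F.
apply: ext0_inj; rewrite ua su !linear_sum; apply: eq_bigr => p _.
rewrite !linearZ -d0; congr (_ *: differential K 0 w (wedge _)).
by apply/ffunP => j; rewrite ffunE [j]ord1.
Qed.
End KoszulComplex.

(** A wedge of positive length over the zero module has a zero entry, so all terms in positive
    degree vanish. *)
Lemma oizero_koszul_acyclic (K : oicomplex (oiext (oizero A))) : acyclic K.
Proof.
move=> i w x _; exists 0; rewrite linear0.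
have [s ->] := wedge_span x; rewrite big1 // => p _.
rewrite (alternating0 (wedge_alternating _ _) (j := ord0)) ?scaler0 //.
exact: thinmx0.
Qed.

End OIModules.

(** * Bases of exterior powers *)

Section ExteriorBasis.
Import GRing.Theory.
Local Open Scope ring_scope.

(** A basis is given with its dual coordinates: [basis_sum] yields generation and [basis_dual]
    independence. *)
Record is_basis (R : comPzRingType) (V : lmodType R) (X : finType)
    (b : X -> V) (c : X -> V -> R^o) : Prop := IsBasis {
  basis_linear : forall x, linear (c x);
  basis_sum : forall v, v = \sum_x (c x v : R) *: b x;
  basis_dual : forall x y, c x (b y) = (x == y)%:R
}.

Lemma linear_fun0 (R : pzRingType) (V W : lmodType R) (f : V -> W) :
  linear f -> f 0 = 0.
Proof. by move=> /(_ (-1) 0 0); rewrite scaler0 add0r scaleN1r addNr. Qed.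

Section WedgeBasis.
Variables (R : comPzRingType) (V : lmodType R) (X : finType).

Section DetFunctional.
Variables (c : X -> V -> R^o) (c_linear : forall x, linear (c x)).
Variables (i : nat) (t : {ffun 'I_i -> X}).

Definition coord_mx (x : {ffun 'I_i -> V}) : 'M[R]_i :=
  \matrix_(p, q) (c (t q) (x p) : R).

Lemma det_coord_alternating :
  alternating (fun x : {ffun 'I_i -> V} => \det (coord_mx x) : R^o).
Proof.
have row'_entry x (j : 'I_i) y z :
    row' j (coord_mx (set_entry x j y)) = row' j (coord_mx (set_entry x j z)).
  by apply/matrixP => p q; rewrite !mxE !ffunE eq_sym (negPf (neq_lift j p)).
have row_entry x (j : 'I_i) a y z :
    row j (coord_mx (set_entry x j (a *: y + z))) =
    a *: row j (coord_mx (set_entry x j y)) + 1 *: row j (coord_mx (set_entry x j z)).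
  by apply/matrixP => p q; rewrite scale1r !mxE !ffunE eqxx c_linear.
(* The summand with coefficient 0 is padding: [determinant_multilinear] expects a combination of two
   rows. *)
have row_entryZ x (j : 'I_i) a y :
    row j (coord_mx (set_entry x j (a *: y))) =
    a *: row j (coord_mx (set_entry x j y)) + 0 *: row j (coord_mx (set_entry x j 0)).
  apply/matrixP => p q; rewrite scale0r addr0 !mxE !ffunE eqxx.
  by rewrite -[a *: y]addr0 c_linear (linear_fun0 (c_linear _)) addr0.
split=> [x j y z|x j a y|x j l lj xjl].
- have := row_entry x j 1 y z; rewrite [1 *: y]scale1r => row_yz.
  rewrite (determinant_multilinear row_yz) ?(row'_entry x j (y + z)) //.
  by rewrite !mul1r.
- rewrite (determinant_multilinear (row_entryZ x j a y)) ?(row'_entry x j (a *: y)) //.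
  by rewrite mul0r addr0.
- apply: (@determinant_alternate _ _ _ j l) => [|q]; last by rewrite !mxE xjl.
  by rewrite -val_eqE /= lj neq_ltn ltnSn.
Qed.

(** The minor of the coordinate matrix on the columns [t], as a linear functional on the exterior
    power. *)
Definition det_coord : {linear extpower V i -> R^o} :=
  sval (cid (alternating_lift det_coord_alternating)).

Lemma det_coord_wedge x : det_coord (wedge x) = \det (coord_mx x).
Proof. exact: (svalP (cid (alternating_lift det_coord_alternating))). Qed.

End DetFunctional.

Variables (b : X -> V) (c : X -> V -> R^o) (bc : is_basis b c) (i : nat).
Variables (Y : finType) (tau : Y -> {ffun 'I_i -> X}).
Hypothesis tau_inj : forall y, injective (tau y).
Hypothesis tau_im : forall y y',
  [set tau y p | p in 'I_i] = [set tau y' p | p in 'I_i] -> y = y'.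
Hypothesis tau_surj : forall t : {ffun 'I_i -> X}, injective t ->
  exists y (s : 'S_i), t = permute s (tau y).

Definition wedge_basis (y : Y) : extpower V i := wedge [ffun p => b (tau y p)].

Definition wedge_coord (y : Y) : extpower V i -> R^o :=
  det_coord (basis_linear bc) (tau y).

(** By the hypotheses on [tau], [Y] indexes the [i]-element subsets of [X], each in one chosen
    order. Minors serve as dual coordinates. *)
Lemma wedge_is_basis : is_basis wedge_basis wedge_coord.
Proof.
have dual y y' : wedge_coord y (wedge_basis y') = (y == y')%:R.
  rewrite /wedge_coord det_coord_wedge; have [<-|yy'] := eqVneq y y'.
    rewrite -[RHS](det1 R i); congr (\det _); apply/matrixP => p q.
    by rewrite !mxE ffunE (basis_dual bc) (inj_eq (@tau_inj y)) eq_sym.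
  (* Distinct sets of equal cardinality: some index of [tau y'] is missing from [tau y], and the
     matrix has a zero row there. *)
  have [p py] : exists p, tau y' p \notin [set tau y q | q in 'I_i].
    apply/existsP; rewrite -negb_forall; apply: contra yy' => /forallP tau_sub.
    apply/eqP/esym/tau_im/eqP; rewrite eqEcard !(card_imset _ (@tau_inj _)) leqnn andbT.
    by apply/subsetP => _ /imsetP[p _ ->].
  rewrite (expand_det_row _ p) big1 // => q _; rewrite mxE ffunE (basis_dual bc).
  case: eqP => [tau_pq|_]; last by rewrite mul0r.
  by case/imsetP: py; exists q.
split=> // [y a u v|u]; first exact: linearP.
pose P (u : extpower V i) := u = \sum_y (wedge_coord y u : R) *: wedge_basis y.
have PD u1 u2 : P u1 -> P u2 -> P (u1 + u2).
  rewrite /P => {1}-> {1}->; rewrite -big_split; apply: eq_bigr => y _ /=.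
  by rewrite [wedge_coord y (_ + _)]linearD scalerDl.
have PZ a u1 : P u1 -> P (a *: u1).
  rewrite /P => {1}->; rewrite scaler_sumr; apply: eq_bigr => y _.
  by rewrite [wedge_coord y (_ *: _)]linearZ scalerA.
have P0 : P 0.
  by rewrite /P big1 // => y _; rewrite [wedge_coord y 0]linear0 scale0r.
have Pb y : P (wedge_basis y).
  rewrite /P (bigD1 y) //= dual eqxx scale1r big1 ?addr0 // => y' /negPf yy'.
  by rewrite dual yy' scale0r.
have wedge_alt := @wedge_alternating R V i.
rewrite -/(P u); have [s ->] := wedge_span u.
apply: (big_ind P P0 PD) => -[a x] _; apply: (PZ) => {a}/=.
(* Generation reduces to wedges of basis vectors: with a repeated index they vanish, otherwise they
   are a sign times some [wedge_basis y]. *)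
apply: (alternating_ind wedge_alt (S := fun _ v => exists z, v = b z) P0 PD PZ)
  => [{}x xb|j].
  have [t xt] := fin_all_exists xb.
  have -> : x = [ffun p => b ([ffun q => t q] p)].
    by apply/ffunP => p; rewrite !ffunE.
  have [/injectiveP t_inj|/injectivePn[p [q pq tpq]]] := boolP (injectiveb [ffun q => t q]).
    have [y [s' ->]] := tau_surj t_inj.
    have -> : [ffun p => b (permute s' (tau y) p)] = permute s' [ffun p => b (tau y p)].
      by apply/ffunP => p; rewrite !ffunE.
    by rewrite (alternating_permute wedge_alt); apply/PZ/Pb.
  rewrite (alternating_eq0 wedge_alt pq); first exact: P0.
  by rewrite [LHS]ffunE [RHS]ffunE tpq.
exists [seq (c z (x j) : R, b z) | z <- enum X].
  by move=> _ /mapP[z _ ->]; exists z.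
by rewrite big_map big_enum; apply: basis_sum.
Qed.

End WedgeBasis.
End ExteriorBasis.

(** * Freeness of the exterior powers of a free OI-module *)

Section OIMorphisms.
Implicit Types l m w : nat.

Lemma oihom_inj m w (e : oihom m w) : injective e.
Proof. by case/andP: (oihomP e) => /injectiveP. Qed.

Lemma leq_oihom m w (e : oihom m w) a b : (e a <= e b)%N = (a <= b)%N.
Proof.
have e_mono (c d : 'I_m) : (c <= d -> e c <= e d)%N.
  by case/andP: (oihomP e) => _ /'forall_forallP/(_ c d)/implyP.
have [/e_mono//|ba] := leqP a b; apply/negbTE; rewrite -ltnNge ltn_neqAle.
by rewrite e_mono ?(ltnW ba) // andbT val_eqE (inj_eq (@oihom_inj _ _ e)) neq_ltn ba.
Qed.

Lemma oi_comp_inj l m w (e : oihom m w) : injective (@oi_comp l m w e).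
Proof.
move=> f g /(congr1 val)/ffunP fg; apply: oihom_eqP => a.
by have := fg a; rewrite !ffunE => /oihom_inj.
Qed.

Lemma oihom_of_mono m w (f : 'I_m -> 'I_w) :
  (forall a b, (f a <= f b)%N = (a <= b)%N) -> exists e : oihom m w, e =1 f.
Proof.
move=> f_mono; have f_pred : oi_pred [ffun a => f a].
  apply/andP; split; last by apply/'forall_forallP=> a b; rewrite !ffunE f_mono implybb.
  apply/injectiveP => a b; rewrite !ffunE => fab.
  by apply/val_inj/anti_leq; rewrite -!f_mono fab leqnn.
by exists (OIHom f_pred) => a; rewrite ffunE.
Qed.

Definition oi_im m w (e : oihom m w) : {set 'I_w} := [set e a | a in [set: 'I_m]].

Lemma card_oi_im m w (e : oihom m w) : #|oi_im e| = m.
Proof. by rewrite card_imset ?cardsT ?card_ord //; apply: oihom_inj. Qed.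

Lemma oi_im_comp l m w (e : oihom m w) (f : oihom l m) :
  oi_im (oi_comp e f) = [set e a | a in oi_im f].
Proof. by rewrite /oi_im -imset_comp; apply: eq_imset => a; rewrite /= ffunE. Qed.

(** The values of a morphism, listed in order, form a strictly increasing sequence, which is
    determined by its set of elements. *)
Lemma oi_im_inj m w (e f : oihom m w) : oi_im e = oi_im f -> e = f.
Proof.
have sorted_im (g : oihom m w) : sorted ltn [seq val (g a) | a <- enum 'I_m].
  have := iota_ltn_sorted 0 m; rewrite -val_enum_ord !sorted_map.
  by apply: etrans; apply: eq_sorted => a b /=; rewrite !ltnNge leq_oihom.
have mem_im (g : oihom m w) v :
    (v \in [seq val (g b) | b <- enum 'I_m]) = (v \in [seq val c | c in oi_im g]).
  apply/mapP/mapP => -[b bP ->]; last first.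
    by move: bP; rewrite mem_enum => /imsetP[d _ ->]; exists d; rewrite ?mem_enum.
  by exists (g b); rewrite ?mem_enum ?imset_f.
move=> ef; apply: oihom_eqP => a; apply: val_inj.
suff /eq_in_map/(_ a)-> : [seq val (e a) | a <- enum 'I_m] =
    [seq val (f a) | a <- enum 'I_m] by rewrite ?mem_enum.
by apply: (irr_sorted_eq ltn_trans ltnn) => // v; rewrite !mem_im ef.
Qed.

Lemma oi_im_surj w (S : {set 'I_w}) : exists e : oihom #|S| w, oi_im e = S.
Proof.
have [a b|e eE] := @oihom_of_mono #|S| w (Order.enum_val (A := mem S)).
  exact: (Order.le_enum_val (@Order.le_total _ _) a b).
exists e; apply/eqP; rewrite eqEcard card_oi_im leqnn andbT.
by apply/subsetP => _ /imsetP[a _ ->]; rewrite eE Order.enum_valP.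
Qed.

(** Preimages under the injective [e] define the factor; it is monotone because [e] reflects the
    order. *)
Lemma oi_factor l m w (e : oihom m w) (f : oihom l w) :
  oi_im f \subset oi_im e -> exists f' : oihom l m, f = oi_comp e f'.
Proof.
move=> /subsetP fe.
have /fin_all_exists[g gE] (a : 'I_l) : exists b, f a = e b.
  have /imsetP[b _ ->] : f a \in oi_im e by apply/fe/imset_f; rewrite inE.
  by exists b.
have [a b|f' f'E] := @oihom_of_mono l m g.
  by rewrite -(leq_oihom e) -!gE leq_oihom.
by exists f'; apply: oihom_eqP => a; rewrite ffunE f'E gE.
Qed.

End OIMorphisms.

(** * Orbits of basis indices, supports and the generators of the exterior powers *)

Section Orbits.
Variables (J : finType) (n : J -> nat).

(* For generators j of width n j, the indices of the basis of width w that they span. *)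
Definition oiorbit w : finType := {j : J & oihom (n j) w}.

Definition orbit_pt w j (nu : oihom (n j) w) : oiorbit w := existT _ j nu.

Definition orbit_map m w (e : oihom m w) (x : oiorbit m) : oiorbit w :=
  orbit_pt (oi_comp e (tagged x)).

Lemma orbit_map_inj m w (e : oihom m w) : injective (orbit_map e).
Proof.
case=> [j f] [j' f'] /eqP; rewrite -tag_eqE /tag_eq /= => /andP[/eqP jj'].
move: f'; rewrite -{}jj' => f'; by rewrite tagged_asE => /eqP/oi_comp_inj->.
Qed.

Definition supp w (Z : {set oiorbit w}) : {set 'I_w} := \bigcup_(x in Z) oi_im (tagged x).

Lemma supp_map m w (e : oihom m w) (Z : {set oiorbit m}) :
  supp [set orbit_map e x | x in Z] = [set e a | a in supp Z].
Proof.
rewrite /supp (big_morph (fun S : {set 'I_m} => [set e a | a in S])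
  (id1 := set0) (op1 := @setU _) (imsetU _) (imset0 _)).
rewrite big_imset /=; last by move=> x y _ _; apply: orbit_map_inj.
by apply: eq_bigr => x _; rewrite oi_im_comp.
Qed.

Lemma leq_card_supp w (Z : {set oiorbit w}) : (#|supp Z| <= #|Z| * \max_j n j)%N.
Proof.
rewrite -sum_nat_const; apply: (@leq_trans (\sum_(x in Z) n (tag x))).
  apply: (big_ind2 (fun (S : {set 'I_w}) k => #|S| <= k)%N) => [|S k S' k' Sk Sk'|x _].
  - by rewrite cards0.
  - by apply: leq_trans (leq_add Sk Sk'); rewrite cardsU leq_subr.
  - by rewrite card_oi_im.
by apply: leq_sum => x _; apply: (leq_bigmax (tag x)).
Qed.

Variable i : nat.

Definition tuple_im w (t : {ffun 'I_i -> oiorbit w}) := [set t p | p in 'I_i].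

Definition arranges w (Z : {set oiorbit w}) : pred {ffun 'I_i -> oiorbit w} :=
  fun s => injectiveb s && (tuple_im s == Z).

(* The last condition selects one ordering of each i-element set. *)
Definition generating w (t : {ffun 'I_i -> oiorbit w}) :=
  [&& injectiveb t, supp (tuple_im t) == setT & choose (arranges (tuple_im t)) t == t].

(** The bound on [m] excludes nothing: by [leq_card_supp], the support of [i] indices has at most
    [i * \max_j n j] elements. It makes the type finite. *)
Definition ext_gen : finType :=
  {m : 'I_(i * \max_j n j).+1 & {t : {ffun 'I_i -> oiorbit m} | generating t}}.

Definition ext_arity (y : ext_gen) : nat := tag y.

Definition tuple_map m w (e : oihom m w) (t : {ffun 'I_i -> oiorbit m}) :
  {ffun 'I_i -> oiorbit w} := [ffun p => orbit_map e (t p)].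

Lemma tuple_im_map m w (e : oihom m w) t :
  tuple_im (tuple_map e t) = [set orbit_map e x | x in tuple_im t].
Proof. by rewrite /tuple_im -imset_comp; apply: eq_imset => p; rewrite /= ffunE. Qed.

Lemma tuple_im_permute w (t s : {ffun 'I_i -> oiorbit w}) : injective t ->
  tuple_im t = tuple_im s -> exists sigma, t = permute sigma s.
Proof.
move=> t_inj ts.
have /fin_all_exists[f fE] (p : 'I_i) : exists q, t p = s q.
  have : t p \in tuple_im s by rewrite -ts; apply: imset_f.
  by case/imsetP=> q _ ->; exists q.
have f_inj : injective f by move=> p q fpq; apply: t_inj; rewrite !fE fpq.
by exists (perm f_inj); apply/ffunP => p; rewrite ffunE permE -fE.
Qed.

End Orbits.

Section ExtTuples.
Variables (J : finType) (n : J -> nat) (i w : nat).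

(** These families play the role of [tau] in [wedge_is_basis]; the next three lemmas are its
    hypotheses. *)
Definition ext_tuple (y : oiorbit (@ext_arity J n i) w) : {ffun 'I_i -> oiorbit n w} :=
  tuple_map (tagged y) (val (tagged (tag y))).

Lemma ext_tuple_inj y : injective (ext_tuple y).
Proof.
move=> p q; rewrite !ffunE => /orbit_map_inj.
by case/and3P: (valP (tagged (tag y))) => /injectiveP + _ _ => /[apply].
Qed.

(** The generating family has full support, so the support of the resulting set is the image of [e],
    which determines [e]. Injectivity of [e] then gives back the generating set, and the chosen
    ordering gives back [t]. *)
Lemma ext_tuple_im_inj y y' :
  tuple_im (ext_tuple y) = tuple_im (ext_tuple y') -> y = y'.
Proof.
case: y y' => [[m [t t_gen]] e] [[m' [t' t'_gen]] e'].
move: e e'; rewrite /ext_arity /= => e e'; rewrite /ext_tuple /= !tuple_im_map => im_tt'.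
case/and3P: (t_gen) => /injectiveP t_inj /eqP t_supp /eqP t_can.
case/and3P: (t'_gen) => /injectiveP t'_inj /eqP t'_supp /eqP t'_can.
have ee' : oi_im e = oi_im e'.
  by have := congr1 (@supp J n w) im_tt'; rewrite !supp_map t_supp t'_supp.
have mm' : m = m' by apply: val_inj; rewrite -[LHS](card_oi_im e) ee' card_oi_im.
case: m' / mm' t' t'_gen e' im_tt' t'_inj t'_supp t'_can ee' =>
  t' t'_gen e' im_tt' t'_inj t'_supp t'_can ee'.
move: im_tt'; rewrite (oi_im_inj ee') => /(imset_inj (@orbit_map_inj _ _ _ _ e')) tt'.
have {t_can t'_can} tt : t = t'.
  (* [choose] depends only on the predicate once its argument satisfies it, and the two predicates
     agree. *)
  rewrite -t_can -t'_can tt'; apply: choose_id; rewrite /arranges ?tt' eqxx andbT.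
    exact/injectiveP.
  exact/injectiveP.
case: t' / tt t'_gen {t'_inj t'_supp tt'} => t'_gen.
by rewrite (bool_irrelevance t_gen t'_gen).
Qed.

(** Let [e] have the support of [t] as its image. Every entry of [t] factors through [e], and the
    resulting family [s] has full support; the chosen ordering of its set is a generator. *)
Lemma ext_tuple_surj (t : {ffun 'I_i -> oiorbit n w}) : injective t ->
  exists y (sigma : 'S_i), t = permute sigma (ext_tuple y).
Proof.
move=> t_inj; have [e eE] := oi_im_surj (supp (tuple_im t)).
have /fin_all_exists[s sE] p : exists x, t p = orbit_map e x.
  have : oi_im (tagged (t p)) \subset oi_im e.
    by rewrite eE /supp; apply: (bigcup_sup (t p)) => //; apply: imset_f.
  case/oi_factor => f tpE; exists (existT _ (tag (t p)) f).
  by rewrite /orbit_map /= -tpE; case: (t p).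
have {sE} tE : t = tuple_map e [ffun p => s p] by apply/ffunP => p; rewrite !ffunE.
move: [ffun p => s p] tE => {}s tE.
have s_inj : injective s by move=> p q spq; apply: t_inj; rewrite tE !ffunE spq.
have s_arr : arranges (tuple_im s) s by rewrite /arranges eqxx andbT; apply/injectiveP.
have s_supp : supp (tuple_im s) = setT.
  apply: (imset_inj (@oihom_inj _ _ e)); rewrite -supp_map -tuple_im_map -tE.
  exact: esym eE.
pose c := choose (arranges (tuple_im s)) s.
have /andP[/injectiveP c_inj /eqP c_im] : arranges (tuple_im s) c by apply: chooseP.
have c_gen : generating c.
  apply/and3P; rewrite c_im s_supp eqxx; split=> //; first exact/injectiveP.
  by apply/eqP; apply: choose_id => //; apply: chooseP.
have m_lt : (#|supp (tuple_im t)| < (i * \max_j n j).+1)%N.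
  rewrite ltnS (leq_trans (leq_card_supp _)) // leq_mul2r; apply/orP; right.
  by rewrite -[leqRHS]card_ord leq_imset_card.
exists (existT _ (existT _ (Ordinal m_lt) (exist _ c c_gen)) e).
apply: tuple_im_permute => //; transitivity (tuple_im (tuple_map e c)) => //.
by rewrite tuple_im_map c_im -tuple_im_map -tE.
Qed.

End ExtTuples.

(** * OI-bases, their exterior powers, and freeness of modules that have one *)

Section OIBases.
Import GRing.Theory.
Local Open Scope ring_scope.

Lemma sum_oiorbit (V : nmodType) (J : finType) (n : J -> nat) w (F : oiorbit n w -> V) :
  \sum_x F x = \sum_j \sum_(nu : oihom (n j) w) F (orbit_pt nu).
Proof. by rewrite sig_big_dep; apply: eq_bigr => -[j nu]. Qed.

Variables (k : comPzRingType) (A : oialg k).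
Implicit Types M N : oimod A.

Section OIBasis.
Variables (M : oimod A) (J : finType) (n : J -> nat) (g : forall j, M (n j)).

Definition orbit_elt w (x : oiorbit n w) : M w := mod_map M (tagged x) (g (tag x)).

Lemma orbit_elt_map m w (e : oihom m w) (x : oiorbit n m) :
  orbit_elt (orbit_map e x) = mod_map M e (orbit_elt x).
Proof. exact: mod_map_comp. Qed.

(** Freeness on the generators [g]. Coordinates are chosen separately in each width; compatibility
    with OI-morphisms is carried by [orbit_elt]. *)
Definition oi_basis := forall w, exists c, is_basis (@orbit_elt w) c.

Definition ext_elt i (y : ext_gen n i) : oiext M i (ext_arity y) :=
  wedge [ffun p => orbit_elt (val (tagged y) p)].
End OIBasis.

(** The wedge basis indexed by [ext_tuple] is the orbit of the elements [ext_elt], since induced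
    maps act on a wedge entry by entry. *)
Lemma ext_oi_basis M (J : finType) (n : J -> nat) (g : forall j : J, M (n j)) i :
  oi_basis g -> oi_basis (ext_elt g (i := i)).
Proof.
move=> g_basis w; have [c gc] := g_basis w.
have ext_basis := wedge_is_basis gc (@ext_tuple_inj J n i w)
  (@ext_tuple_im_inj J n i w) (@ext_tuple_surj J n i w).
have eltE : @orbit_elt (oiext M i) _ _ (ext_elt g (i := i)) w =
    wedge_basis (@orbit_elt M J n g w) (@ext_tuple J n i w).
  apply: funext => y; rewrite /orbit_elt [LHS]extpower_map_wedge.
  congr wedge; apply/ffunP => p; rewrite /ext_tuple !ffunE.
  exact: esym (orbit_elt_map _ _ _).
by exists (wedge_coord gc (@ext_tuple J n i w)); rewrite eltE.
Qed.

Lemma oi_basis_isomorphic M N (f : oimod_hom M N) (f' : oimod_hom N M)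
    (J : finType) (n : J -> nat) (g : forall j : J, N (n j)) w c :
  mutually_inverse f f' -> is_basis (@orbit_elt N J n g w) c ->
  is_basis (@orbit_elt M J n (fun j => f' (n j) (g j)) w) (fun x v => c x (f w v)).
Proof.
move=> ff' [c_linear c_sum c_dual].
have elt x : @orbit_elt M J n (fun j => f' (n j) (g j)) w x = f' w (orbit_elt g x).
  by rewrite /orbit_elt hom_natural.
split=> [x a u v|v|x y].
- by rewrite linearP c_linear.
- rewrite -[LHS](ff' w).1 {1}[f w v]c_sum linear_sum; apply: eq_bigr => x _.
  by rewrite linearZ elt.
- by rewrite elt (ff' w).2 c_dual.
Qed.

Section FreeHom.
Variables (M : oimod A) (n : nat) (x : M n).

(** Universal property of the free module of width [n]: the basis element of the identity goes to
    [x]. *)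
Definition free_hom_at w (y : free_at A n w) : M w :=
  \sum_nu (y nu : A w) *: mod_map M nu x.

Lemma free_hom_linear w : linear (@free_hom_at w).
Proof.
move=> a y z; rewrite /free_hom_at scaler_sumr -big_split; apply: eq_bigr => nu _ /=.
by rewrite !ffunE scalerDl scalerA.
Qed.
HB.instance Definition _ w :=
  GRing.isLinear.Build _ _ _ _ (@free_hom_at w) (@free_hom_linear w).

Lemma free_hom_basis w (nu : oihom n w) :
  free_hom_at (free_basis A nu) = mod_map M nu x.
Proof.
rewrite /free_hom_at (bigD1 nu) //= ffunE eqxx scale1r big1 ?addr0 // => mu.
by move=> /negPf mu_nu; rewrite ffunE mu_nu scale0r.
Qed.

Lemma free_hom_natural m w (e : oihom m w) (y : oifree A n m) :
  free_hom_at (mod_map (oifree A n) e y) = mod_map M e (free_hom_at y).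
Proof.
rewrite /= /free_map !linear_sum; apply: eq_bigr => nu _.
by rewrite !linearZ /= free_hom_basis mod_map_comp.
Qed.

Definition free_hom : oimod_hom (oifree A n) M :=
  @OIModHom k A (oifree A n) M (fun w => @free_hom_at w) free_hom_natural.
End FreeHom.

Section SumHom.
Variables (M N P : oimod A) (f : oimod_hom M P) (h : oimod_hom N P).

Definition dsum_hom_at w (x : (M w * N w)%type) : P w := f w x.1 + h w x.2.

Lemma dsum_hom_linear w : linear (@dsum_hom_at w).
Proof. by move=> a x y; rewrite /dsum_hom_at !linearP scalerDr addrACA. Qed.
HB.instance Definition _ w :=
  GRing.isLinear.Build _ _ _ _ (@dsum_hom_at w) (@dsum_hom_linear w).

Lemma dsum_hom_natural m w (e : oihom m w) (x : oidsum M N m) :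
  dsum_hom_at (mod_map (oidsum M N) e x) = mod_map P e (dsum_hom_at x).
Proof. by rewrite /dsum_hom_at linearD !hom_natural. Qed.

Definition dsum_hom : oimod_hom (oidsum M N) P :=
  @OIModHom k A (oidsum M N) P (fun w => @dsum_hom_at w) dsum_hom_natural.
End SumHom.

Section ZeroHom.
Variable M : oimod A.

Lemma zero_hom_linear w : linear (fun _ : oizero A w => 0 : M w).
Proof. by move=> a x y; rewrite scaler0 addr0. Qed.

Lemma zero_hom_natural m w (e : oihom m w) (x : oizero A m) :
  0 = mod_map M e 0.
Proof. by rewrite linear0. Qed.

Definition zero_hom : oimod_hom (oizero A) M :=
  @OIModHom k A (oizero A) M (fun w => HB.pack_for {linear oizero A w -> M w}
    (fun _ : oizero A w => 0 : M w)
    (GRing.isLinear.Build _ _ _ _ _ (@zero_hom_linear w))) zero_hom_natural.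
End ZeroHom.

(** The generators define a morphism [h] from a free module, natural by construction; it remains to
    invert it in each width by [h'], which reads off coordinates. Both follow the recursion of
    [free_dsum] on a list. *)
Lemma fg_free_of_oi_basis M (J : finType) (n : J -> nat) (g : forall j : J, M (n j)) :
  oi_basis g -> fg_free M.
Proof.
move=> g_basis.
pose h := fix h (s : seq J) : oimod_hom (free_dsum A (map n s)) M :=
  if s is j :: s' then dsum_hom (free_hom (g j)) (h s') else zero_hom M.
exists (map n (enum J)); apply: isomorphic_sym.
exists (h (enum J)); apply: bijective_isomorphism => w.
have [c [c_linear c_sum c_dual]] := g_basis w.
pose cl (x : oiorbit n w) : {linear M w -> (A w)^o} :=
  HB.pack (c x) (GRing.isLinear.Build _ _ _ _ _ (c_linear x)).
pose h' := fix h' (s : seq J) (v : M w) : free_dsum A (map n s) w :=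
  if s is j :: s' then ([ffun nu : oihom (n j) w => cl (orbit_pt nu) v], h' s' v) else 0.
have hE s v : h s w (h' s v) =
    \sum_(j <- s) \sum_(nu : oihom (n j) w) (cl (orbit_pt nu) v : A w) *: mod_map M nu (g j).
  elim: s => [|j s IHs] /=; first by rewrite big_nil.
  rewrite /dsum_hom_at /= big_cons IHs; congr (_ + _).
  by apply: eq_bigr => nu _; rewrite ffunE.
have c_out s (y : free_dsum A (map n s) w) j (nu : oihom (n j) w) :
    j \notin s -> cl (orbit_pt nu) (h s w y) = 0.
  elim: s y => [|j' s IHs] y; first by move=> _; apply: linear0.
  rewrite inE negb_or => /andP[jj' js].
  rewrite [h _ w y]/(free_hom_at (g j') y.1 + h s w y.2) linearD IHs // addr0.
  rewrite /free_hom_at linear_sum big1 // => mu _; rewrite linearZ.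
  rewrite [cl _ _](c_dual _ (orbit_pt mu)) -tag_eqE /tag_eq /= (negPf jj').
  exact: mulr0.
(* Distinctness of the list separates head from tail: coordinates of later generators vanish on the
   head summand, and by [c_out] those of the head vanish on the tail. *)
have c_in s (y : free_dsum A (map n s) w) : uniq s -> h' s (h s w y) = y.
  have h'D s' u v : h' s' (u + v) = h' s' u + h' s' v.
    elim: s' => [|j s' IHs] /=; first by rewrite addr0.
    rewrite IHs; congr pair; apply/ffunP => nu; rewrite !ffunE.
    exact: (linearD (cl _)).
  have h'0 s' u : (forall j, j \in s' -> forall nu, cl (@orbit_pt _ n w j nu) u = 0) ->
      h' s' u = 0.
    elim: s' => [//|j s' IHs] cu0 /=; rewrite IHs; last first.
      by move=> j' j's'; apply: cu0; rewrite inE j's' orbT.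
    congr pair; apply/ffunP => nu; rewrite !ffunE; apply: cu0.
    by rewrite inE eqxx.
  elim: s y => [|j s IHs] y; first by move=> _; rewrite [y]thinmx0.
  case/andP => js s_uniq; case: y => y z.
  pose u := free_hom_at (g j) y + h s w z.
  rewrite -[LHS]/([ffun nu : oihom (n j) w => cl (orbit_pt nu) u], h' s u) h'D IHs //.
  rewrite [h' s _]h'0 => [|j' j's nu]; last first.
    rewrite /free_hom_at linear_sum big1 // => mu _; rewrite linearZ.
    rewrite [cl _ _](c_dual _ (orbit_pt mu)) -tag_eqE /tag_eq /=.
    have [j'j|_] := eqVneq j' j; last exact: mulr0.
    by rewrite -j'j j's in js.
  rewrite add0r; congr pair; apply/ffunP => nu; rewrite ffunE linearD c_out // addr0.
  rewrite /free_hom_at linear_sum (bigD1 nu) // big1 => [|mu mu_nu].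
    rewrite linearZ [cl _ _](c_dual _ (orbit_pt nu)) eqxx.
    exact: etrans (addr0 _) (mulr1 _).
  rewrite linearZ [cl _ _](c_dual _ (orbit_pt mu)) -tag_eqE /tag_eq /= eqxx.
  by rewrite tagged_asE eq_sym (negPf mu_nu); apply: mulr0.
exists (h' (enum J)) => [y|v]; first exact/c_in/enum_uniq.
by rewrite hE big_enum [RHS]c_sum sum_oiorbit.
Qed.
End OIBases.

(** * Explicit bases of finite direct sums of free modules *)

Section FreeBases.
Import GRing.Theory.
Local Open Scope ring_scope.

Lemma sum_option (V : nmodType) (J : finType) (F : option J -> V) :
  \sum_o F o = F None + \sum_j F (Some j).
Proof.
rewrite (bigD1 None) //= (reindex_omap Some id) /=; last by case.
by congr (_ + _); apply: eq_bigl => j; rewrite eqxx.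
Qed.

Variables (k : comPzRingType) (A : oialg k).
Implicit Types M N : oimod A.

Section Cons.
Variables (m : nat) (N : oimod A) (J : finType) (n : J -> nat) (g : forall j, N (n j)).

Definition cons_arity (o : option J) : nat := if o is Some j then n j else m.

Definition cons_gen (o : option J) : oidsum (oifree A m) N (cons_arity o) :=
  match o with
  | Some j => (0, g j)
  | None => (free_basis A (oi_id m), 0)
  end.

Variables (w : nat) (c : oiorbit n w -> N w -> (A w)^o).

Definition cons_coord (x : oiorbit cons_arity w) (v : oidsum (oifree A m) N w) : (A w)^o :=
  match x with
  | existT (Some j) nu => c (orbit_pt (nu : oihom (n j) w)) v.2
  | existT None nu => (v.1 : free_at A m w) nu
  end.

Lemma cons_is_basis :
  is_basis (@orbit_elt _ _ N J n g w) c ->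
  is_basis (@orbit_elt _ _ _ _ _ cons_gen w) cons_coord.
Proof.
case=> c_linear c_sum c_dual.
have eltS j (nu : oihom (n j) w) :
    @orbit_elt _ _ _ _ _ cons_gen w (@orbit_pt _ cons_arity w (Some j) nu) =
    (0, orbit_elt g (orbit_pt nu)).
  by rewrite /orbit_elt /= /dsum_map linear0.
have eltN (nu : oihom m w) :
    @orbit_elt _ _ _ _ _ cons_gen w (@orbit_pt _ cons_arity w None nu) =
    (free_basis A nu, 0).
  by rewrite /orbit_elt /= /dsum_map linear0 /= free_map_basis oi_comp_id.
split.
- by case=> -[j|] nu a u v /=; [apply: c_linear | rewrite !ffunE].
- case=> y z; rewrite sum_oiorbit sum_option.
  under eq_bigr do rewrite eltN.
  under [in X in _ + X]eq_bigr do under eq_bigr do rewrite eltS.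
  apply: injective_projections.
    rewrite [RHS](raddfD fst) !(raddf_sum fst) [X in _ + X]big1 => [|j _]; last first.
      by rewrite (raddf_sum fst) big1 // => nu _; apply: scaler0.
    by rewrite addr0 -[LHS]free_sum_basis.
  rewrite [RHS](raddfD snd) !(raddf_sum snd) [X in X + _]big1 => [|nu _]; last first.
    exact: scaler0.
  rewrite add0r [LHS]c_sum sum_oiorbit; apply: eq_bigr => j _.
  by rewrite (raddf_sum snd).
- have eqN (nu nu' : oihom m w) : (@orbit_pt _ cons_arity w None nu ==
      @orbit_pt _ cons_arity w None nu') = (nu == nu').
    by rewrite -tag_eqE /tag_eq /= tagged_asE.
  have eqS j j' (nu : oihom (n j) w) (nu' : oihom (n j') w) :
      (@orbit_pt _ cons_arity w (Some j) nu == @orbit_pt _ cons_arity w (Some j') nu') =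
      (orbit_pt nu == orbit_pt nu').
    rewrite -!tag_eqE /tag_eq /= -[Some j == Some j']/(j == j').
    have [jj'|//] := eqVneq j j'; case: j' / jj' in nu' *.
    by rewrite !tagged_asE.
  case=> -[j|] nu [[j'|] nu']; rewrite -/(orbit_pt nu) -/(orbit_pt nu').
  - by rewrite eltS eqS; apply: c_dual.
  - rewrite eltN; exact: linear_fun0 (c_linear _).
  - by rewrite eltS /= ffunE.
  - by rewrite eltN eqN /= ffunE.
Qed.
End Cons.

(** The basis is fixed before any grading is given, so it serves the ungraded and the graded case
    alike; a coordinate lowers degrees by the degree of its generator. *)
Lemma free_dsum_basis (ncs : seq (nat * int)) :
  exists (J : finType) (n : J -> nat) (deg : J -> int)
         (g : forall j, free_dsum A (map fst ncs) (n j)),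
  forall w, exists2 c, is_basis (@orbit_elt _ _ _ J n g w) c
    & forall (gA : forall w, int -> set (A w)) d x, @free_dsum_gr k A gA ncs w d x ->
      forall y, gA w (d - deg (tag y)) (c y x).
Proof.
elim: ncs => [|[m e] ncs [J [n [deg [g gP]]]]].
  exists void, (fun=> 0%N), (fun=> 0), (fun j : void => match j with end) => w.
  exists (fun _ _ => 0) => [|gA d x _ [[]]]; split=> [[[]]|v|[[]]].
  by rewrite [LHS]thinmx0 big1 // => -[[]].
exists (option J), (cons_arity m n), (fun o => if o is Some j then deg j else e).
exists (cons_gen m g) => w; have [c gc c_gr] := gP w.
exists (@cons_coord m (free_dsum A (map fst ncs)) J n w c); first exact: cons_is_basis.
move=> gA d x [x1_gr x2_gr] [[j|] nu] /=; first exact: c_gr.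
exact: x1_gr.
Qed.

Lemma ext_fg_free (F : oimod A) i : fg_free F -> fg_free (oiext F i).
Proof.
(* All generators are placed in degree 0, only to bring the list into the form of
   [free_dsum_basis]. *)
case=> ns; have -> : ns = map fst [seq (m, 0 : int) | m <- ns].
  by rewrite -map_comp map_id.
move: [seq (m, 0 : int) | m <- ns] => ncs [f [f' ff']].
have [J [n [deg [g gP]]]] := free_dsum_basis ncs.
apply: (fg_free_of_oi_basis (g := ext_elt (i := i) (fun j => f' (n j) (g j)))).
apply: ext_oi_basis => w; have [c gc _] := gP w.
by exists (fun x v => c x (f w v)); apply: oi_basis_isomorphic.
Qed.

End FreeBases.

(** * Gradings *)

Section Grading.
Import GRing.Theory.
Local Open Scope ring_scope.

Section IsGrading.
Variables (V : zmodType) (g : int -> set V) (gV : is_grading g).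

Lemma gradingN d x : g d x -> g d (- x).
Proof. by move=> gx; rewrite -sub0r; apply: gradingB (grading0 gV d) gx. Qed.

Lemma gradingD d x y : g d x -> g d y -> g d (x + y).
Proof. by move=> gx gy; rewrite -[y]opprK; apply: gradingB => //; apply: gradingN. Qed.

Lemma grading_bigsum d I (r : seq I) (P : pred I) F :
  (forall i, P i -> g d (F i)) -> g d (\sum_(i <- r | P i) F i).
Proof.
move=> gF; apply: (big_ind (g d)) => //; first exact: grading0.
by move=> x y; apply: gradingD.
Qed.

End IsGrading.

(** Terms of equal degree are merged, which produces the distinct degrees demanded by
    [grading_sum]. *)
Lemma collect_degrees (V : zmodType) (g : int -> set V) (s : seq (int * V)) :
    (forall d, g d 0) -> (forall d x y, g d x -> g d y -> g d (x + y)) ->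
    (forall p, p \in s -> g p.1 p.2) ->
  exists (r : seq int) (c : int -> V),
    [/\ uniq r, forall d, g d (c d) & \sum_(p <- s) p.2 = \sum_(d <- r) c d].
Proof.
move=> g0 gD gs; exists (undup (map fst s)).
exists (fun d => \sum_(p <- s | p.1 == d) p.2); split.
- exact: undup_uniq.
- move=> d; rewrite big_seq_cond; apply: (big_ind (g d)) => // [x y|p]; first exact: gD.
  by case/andP => /gs + /eqP <-.
- rewrite (exchange_big_dep predT) //= big_seq [RHS]big_seq.
  apply: eq_bigr => p ps; rewrite big_mkcond (bigD1_seq p.1) ?undup_uniq //=.
    by rewrite eqxx big1 ?addr0 // => d /negPf; rewrite eq_sym => ->.
  by rewrite mem_undup map_f.
Qed.

Variables (k : comPzRingType) (A : oialg k) (F : oimod A).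
Variables (gA : forall w, int -> set (A w)) (gF : forall w, int -> set (F w)).
Hypotheses (gAP : graded_oialg gA) (gFP : graded_oimod gA gF).

Lemma grading1 w : gA 0 (1 : A w).
Proof. by rewrite -(rmorph1 (alg_scal A w)); apply: oialg_graded_scal. Qed.

Lemma grading_sign w d (a : A w) m : gA d a -> gA d ((-1) ^+ m * a).
Proof.
move=> ga; rewrite -signr_odd mulr_sign; case: ifP => // _.
exact: (gradingN (oialg_grading gAP w)).
Qed.

Lemma grading_prod w I (r : seq I) (d : I -> int) (a : I -> A w) :
  (forall j, gA (d j) (a j)) -> gA (\sum_(j <- r) d j) (\prod_(j <- r) a j).
Proof.
move=> ga; elim: r => [|j r IHr]; first by rewrite !big_nil; apply: grading1.
by rewrite !big_cons; apply: oialg_gradedM.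
Qed.

Section Ext.
Variable i : nat.
Local Notation gE w := (@ext_gr k A gA F gF i w).

Lemma ext_gr0 w d : gE w d 0.
Proof. by exists [::]; rewrite ?big_nil. Qed.

Lemma ext_grD w d u v : gE w d u -> gE w d v -> gE w d (u + v).
Proof.
move=> [s sP ->] [t tP ->]; exists (s ++ t); last by rewrite big_cat.
by move=> p; rewrite mem_cat => /orP[/sP|/tP].
Qed.

Lemma ext_gr_sum w d I (r : seq I) (G : I -> oiext F i w) :
  (forall j, gE w d (G j)) -> gE w d (\sum_(j <- r) G j).
Proof.
by move=> gG; apply: (big_ind (gE w d)) => // [|u v]; [apply: ext_gr0|apply: ext_grD].
Qed.

Lemma ext_gr_wedge w d (a : A w) (x : {ffun 'I_i -> F w}) (c : 'I_i -> int) :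
  gA d a -> (forall j, gF (c j) (x j)) -> gE w (d + \sum_j c j) (a *: wedge x).
Proof.
move=> ga gx; exists [:: (a, x)]; last by rewrite big_seq1.
by move=> p; rewrite inE => /eqP->; exists d, c.
Qed.

Lemma ext_grZ w d e (a : A w) u : gA d a -> gE w e u -> gE w (d + e) (a *: u).
Proof.
move=> ga [s sP ->]; exists [seq (a * p.1, p.2) | p <- s].
  move=> _ /mapP[p ps ->] /=; have [d0 [c [gp gx ->]]] := sP p ps.
  exists (d + d0), c; split=> //; first exact: oialg_gradedM.
  by rewrite addrA.
by rewrite big_map scaler_sumr; apply: eq_bigr => p _; rewrite scalerA.
Qed.

Lemma ext_grN w d u : gE w d u -> gE w d (- u).
Proof.
move=> gu; rewrite -scaleN1r -[d]add0r; apply: ext_grZ => //.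
exact/(gradingN (oialg_grading gAP w))/grading1.
Qed.

Lemma ext_gr_map m w (e : oihom m w) d u :
  gE m d u -> gE w d (mod_map (oiext F i) e u).
Proof.
move=> [s sP ->]; exists [seq (alg_map A e p.1, map_entries (mod_map F e) p.2) | p <- s].
  move=> _ /mapP[p ps ->] /=; have [d0 [c [gp gx ->]]] := sP p ps.
  exists d0, c; split=> //; first exact: oialg_graded_map.
  by move=> j; rewrite ffunE; apply: (oimod_graded_map gFP).
rewrite big_map linear_sum; apply: eq_bigr => p _.
exact: extpower_mapZ_wedge.
Qed.

(** Coefficients and entries split into homogeneous parts, and [alternating_ind] expands the wedges
    accordingly. *)
Lemma ext_gr_decompose w (u : oiext F i w) :
  exists2 s : seq (int * oiext F i w), (forall p, p \in s -> gE w p.1 p.2)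
    & u = \sum_(p <- s) p.2.
Proof.
pose P (u : oiext F i w) := exists2 s : seq (int * oiext F i w),
  (forall p, p \in s -> gE w p.1 p.2) & u = \sum_(p <- s) p.2.
have P0 : P 0 by exists [::]; rewrite ?big_nil.
have PD u1 u2 : P u1 -> P u2 -> P (u1 + u2).
  move=> [s sP ->] [t tP ->]; exists (s ++ t); last by rewrite big_cat.
  by move=> p; rewrite mem_cat => /orP[/sP|/tP].
have PZ a u1 : P u1 -> P (a *: u1).
  have [s [c [_ gc ->]]] := grading_sum (oialg_grading gAP w) a.
  case=> t tP ->; exists [seq (d + p.1, c d *: p.2) | d <- s, p <- t].
    move=> _ /allpairsP[[d p] [/= ds pt ->]] /=; apply: ext_grZ (gc d) _.
    exact: tP.
  rewrite big_allpairs_dep /= scaler_suml; apply: eq_bigr => d _.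
  by rewrite scaler_sumr.
rewrite -/(P u); have [s ->] := wedge_span u.
apply: (big_ind P P0 PD) => p _; apply: (PZ); move: p.2 => x.
apply: (alternating_ind (wedge_alternating _ _)
  (S := fun _ v => exists d, gF (w := w) d v) P0 PD PZ) => [y yP|j].
  have [c gy] := fin_all_exists yP; exists [:: (0 + \sum_j c j, wedge y)].
    move=> p0; rewrite inE => /eqP->; rewrite -[wedge y]scale1r.
    by apply: ext_gr_wedge => //; apply: grading1.
  by rewrite big_seq1.
have [r [c [_ gc ->]]] := grading_sum (oimod_grading gFP w) (x j).
exists [seq (1, c d) | d <- r]; first by move=> _ /mapP[d _ ->]; exists d.
by rewrite big_map; apply: eq_bigr => d _; rewrite scale1r.
Qed.

(** In the Leibniz expansion, the term of [sigma] is a product of entries of degrees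
    [e q - deg (t (sigma q))], whose total does not depend on [sigma]. *)
Lemma det_coord_graded w (X : finType) (c : X -> F w -> (A w)^o) (deg : X -> int)
    (c_linear : forall x, linear (c x)) (t : {ffun 'I_i -> X}) d u :
    (forall e v, gF e v -> forall x, gA (e - deg x) (c x v : A w)) ->
  gE w d u -> gA (d - \sum_p deg (t p)) (det_coord c_linear t u : A w).
Proof.
move=> c_gr [s sP ->]; rewrite linear_sum [X in gA _ X]big_seq.
apply: (grading_bigsum (oialg_grading gAP w)) => p ps.
have [d0 [e [gp gx ->]]] := sP p ps.
rewrite linearZ [det_coord _ _ _]det_coord_wedge -addrA; apply: oialg_gradedM => //.
apply: (grading_bigsum (oialg_grading gAP w)) => sigma _; apply: grading_sign.
have -> : \sum_j e j - \sum_q deg (t q) = \sum_q (e q - deg (t (sigma q))).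
  rewrite sumrB; congr (_ - _); apply: reindex_inj; exact: perm_inj.
by apply: grading_prod => q; rewrite mxE; apply: c_gr.
Qed.

(** Each wedge coordinate shifts degrees by a constant [D], so the coordinates of the [v d] lie in
    distinct degrees of the algebra and sum to zero; directness there kills each of them. *)
Lemma ext_gr_direct w (J : finType) (n : J -> nat) (b : oiorbit n w -> F w) c deg :
    is_basis b c -> (forall e v, gF e v -> forall x, gA (e - deg x) (c x v : A w)) ->
  forall (s : seq int) (v : int -> oiext F i w), uniq s -> (forall d, gE w d (v d)) ->
    \sum_(d <- s) v d = 0 -> forall d, d \in s -> v d = 0.
Proof.
move=> bc c_gr s v s_uniq gv v_sum d ds.
have ext_basis := wedge_is_basis bc (@ext_tuple_inj J n i w)
  (@ext_tuple_im_inj J n i w) (@ext_tuple_surj J n i w).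
rewrite (basis_sum ext_basis (v d)) big1 // => y _.
pose D := \sum_p deg (ext_tuple y p).
suff -> : wedge_coord bc (@ext_tuple J n i w) y (v d) = 0 by rewrite scale0r.
(* Reindexed by the shift, so that [a e] is homogeneous of degree [e]. *)
pose a e : A w := wedge_coord bc (@ext_tuple J n i w) y (v (e + D)).
have -> : wedge_coord bc (@ext_tuple J n i w) y (v d) = a (d - D) by rewrite /a subrK.
apply: (grading_direct (oialg_grading gAP w) (s := [seq e - D | e <- s])) => [|e||].
- by rewrite map_inj_uniq //; apply: addIr.
- by rewrite -[e in gA e](addrK D); apply: det_coord_graded.
- rewrite big_map /a; under eq_bigr do rewrite subrK.
  by rewrite -[LHS]linear_sum v_sum linear0.
- exact: map_f.
Qed.

End Ext.
End Grading.

(** * The Koszul complex in the graded setting *)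

Section GradedKoszul.
Import GRing.Theory.
Local Open Scope ring_scope.
Variables (k : comPzRingType) (A : oialg k) (F : oimod A).
Variables (gA : forall w, int -> set (A w)) (gF : forall w, int -> set (F w)).
Hypotheses (gAP : graded_oialg gA) (gFP : graded_oimod gA gF).

Lemma graded_fg_free_basis w : graded_fg_free gA gF ->
  exists (J : finType) (n : J -> nat) (b : oiorbit n w -> F w) c (deg : oiorbit n w -> int),
    is_basis b c /\
    forall e v, gF e v -> forall x, gA (e - deg x) (c x v : A w).
Proof.
case=> ncs [f [f' [ff' f_gr _]]].
have [J [n [deg [g gP]]]] := free_dsum_basis A ncs.
have [c gc c_gr] := gP w.
exists J, n, (@orbit_elt _ _ F J n (fun j => f' (n j) (g j)) w).
exists (fun x v => c x (f w v)), (fun x => deg (tag x)); split.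
  exact: oi_basis_isomorphic.
by move=> e v /f_gr v_gr x; apply: c_gr.
Qed.

Lemma ext_graded_oimod i : graded_fg_free gA gF ->
  graded_oimod gA (fun w => @ext_gr k A gA F gF i w).
Proof.
move=> gF_free; split=> [w|w d e a x|m n f d x]; first split.
- by move=> d; apply: ext_gr0.
- by move=> d x y gx gy; apply: ext_grD => //; apply: ext_grN.
- move=> x; have [s sP ->] := ext_gr_decompose gAP gFP x.
  apply: collect_degrees sP => [d|d u v]; first exact: ext_gr0.
  exact: ext_grD.
- move=> s v s_uniq gv v_sum.
  have [J [n [b [c [deg [bc c_gr]]]]]] := graded_fg_free_basis w gF_free.
  exact: (ext_gr_direct gAP bc c_gr s_uniq gv v_sum).
- exact: ext_grZ.
- exact: ext_gr_map.
Qed.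

(** Omitting entry [j] removes its degree from the wedge, and the factor [phi w (x j)] returns it to
    the coefficient. *)
Lemma koszul_graded (phi : oimod_hom F (oireg A)) (K : oicomplex (oiext F)) i :
    graded_hom gF (gA : forall w, int -> set (oireg A w)) phi ->
    is_koszul_complex phi K ->
  graded_hom (fun w => @ext_gr k A gA F gF i.+1 w) (fun w => @ext_gr k A gA F gF i w)
    (differential K i).
Proof.
move=> phi_gr phiK w d _ [s sP ->].
rewrite linear_sum big_seq; apply: (big_ind (@ext_gr k A gA F gF i w d)) => [|u v|p ps].
- exact: ext_gr0.
- exact: ext_grD.
have [d0 [c [gp gx ->]]] := sP p ps; rewrite linearZ /= phiK scaler_sumr.
apply: ext_gr_sum => j; rewrite scalerA (bigD1_ord j) //= addrA.
apply: ext_gr_wedge => [|l]; last by rewrite ffunE.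
apply: oialg_gradedM => //; apply: grading_sign => //; exact: phi_gr.
Qed.
End GradedKoszul.

(** * The acyclic instance and the final assembly *)

Section ConstantAlgebra.
Variable k : comPzRingType.
Definition const_oialg : oialg k :=
  @OIAlg k (fun=> k) (fun=> idfun) (fun _ _ _ => idfun)
    (fun _ _ _ _ => erefl) (fun _ _ => erefl) (fun _ _ _ _ _ _ => erefl).

Lemma oizero_fg_free (A : oialg k) : fg_free (oizero A).
Proof.
exists [::], (zero_hom (oizero A)); apply: bijective_isomorphism => w.
by exists id => x; rewrite [RHS]thinmx0.
Qed.
End ConstantAlgebra.

Theorem theorem5p1 (k : comPzRingType) :
  (forall (A : oialg k) (F : oimod A) (phi : oimod_hom F (oireg A)),
    fg_free F ->
    exists K : oicomplex (oiext F),
      [/\ is_koszul_complex phi K,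
          (forall i, fg_free (oiext F i)) /\ is_isomorphism (ext0 F),
          acyclic K -> resolves K (oicoker phi)
        & forall (gA : forall w, int -> set (A w))
                 (gF : forall w, int -> set (F w)),
            graded_oialg gA -> graded_oimod gA gF -> graded_fg_free gA gF ->
            graded_hom gF (gA : forall w, int -> set (oireg A w)) phi ->
            graded_complex gA (ext_gr gA gF) K])
  /\
  (exists (A : oialg k) (F : oimod A) (phi : oimod_hom F (oireg A)),
    fg_free F /\
    exists K : oicomplex (oiext F), is_koszul_complex phi K /\ acyclic K).
Proof.
split=> [A F phi F_free|].
  have K_koszul := koszul_complexP phi.
  exists (koszul_complex phi); split=> //.
  - by split; [move=> i; apply: ext_fg_free | apply: ext0_isomorphism].
  - by move=> K_acyclic; split=> //; apply: koszul_homology0.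
  - move=> gA gF gAP gFP gF_free phi_gr; split=> i; first exact: ext_graded_oimod.
    exact: (koszul_graded gAP phi_gr K_koszul).
exists (const_oialg k), (oizero _), (zero_hom _); split; first exact: oizero_fg_free.
exists (koszul_complex (zero_hom _)); split; first exact: koszul_complexP.
exact: oizero_koszul_acyclic.
Qed.
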